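(* There exists an absolute constant $C$ such that for every $n\ge 2$, every hyperplane $H=\theta^\perp\subset\mathbb R^n$ ($\theta\in S^{n-1}$) and every linear map $T$, if $X$ is a random vector uniformly distributed on $P_HB_\infty^n$, then $$\operatorname{Var}|TX|^2\le C\,\lambda_{TX}^2\,\mathbb E|TX|^2 .$$
   Context: $B_\infty^n=[-1,1]^n$ is the unit ball of $\ell_\infty^n$, $P_H$ is the orthogonal projection onto $H$, $|\cdot|$ is the Euclidean norm, and ''uniformly distributed'' refers to $(n-1)$-dimensional Lebesgue measure on $H$. For a centered random vector $Z$, $\lambda_Z^2=\sup_{\xi}\mathbb E\langle Z,\xi\rangle^2$, the supremum being over Euclidean unit vectors $\xi$ (this is the largest eigenvalue of the covariance matrix of $Z$). ''Absolute constant'' means a positive number independent of $n$, $H$ and $T$. *)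

(* Defs.v *)
From HB Require Import structures.
From mathcomp Require Import all_boot all_order all_algebra.
From mathcomp Require Import all_classical all_reals all_analysis.

Set Implicit Arguments.
Unset Strict Implicit.
Unset Printing Implicit Defensive.

Import Order.TTheory GRing.Theory Num.Theory.
Import numFieldNormedType.Exports.

Local Open Scope classical_set_scope.
Local Open Scope ring_scope.

(* m-dimensional Lebesgue measure, on the product sigma-algebra of R^m, as the
   m-fold iterated product of the one-dimensional one; lebesgue_tuple_box
   confirms the expected value on boxes. *)
Section LebesgueTuple.
Context {R : realType}.
Local Open Scope ereal_scope.

Definition tuple_cons m (p : measurableTypeR R * m.-tuple (measurableTypeR R)) :
  m.+1.-tuple (measurableTypeR R) := [tuple of p.1 :: p.2].

Lemma measurable_tuple_cons m : measurable_fun setT (@tuple_cons m).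
Proof. exact: measurable_cons. Qed.

Section Step.
Variable m : nat.
Variable mu : {sigma_finite_measure set (m.-tuple (measurableTypeR R)) -> \bar R}.

Definition lebesgue_tuple_step : set (m.+1.-tuple (measurableTypeR R)) -> \bar R :=
  pushforward (lebesgue_measure \x mu) (@tuple_cons m).

HB.instance Definition _ := Measure.copy lebesgue_tuple_step
  (measure_function_pushforward__canonical__measure_function_Measure
     (lebesgue_measure \x mu) (@measurable_tuple_cons m)).

Let lebesgue_tuple_step_sigma_finite : sigma_finite setT lebesgue_tuple_step.
Proof.
pose g (t : m.+1.-tuple (measurableTypeR R)) :
    measurableTypeR R * m.-tuple (measurableTypeR R) :=
  (thead t, [tuple of behead t]).
have mg : measurable_fun setT g.
  apply: measurable_fun_pair => /=.
    exact: measurable_tnth.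
  exact: measurable_behead.
have gK p : g (tuple_cons p) = p.
  by case: p => x t; rewrite /g /tuple_cons theadE/=; congr pair; exact: val_inj.
have /sigma_finiteP[F [TF ndF Foo]] :=
  sigma_finiteT (lebesgue_measure : {sigma_finite_measure set (measurableTypeR R) -> \bar R}).
have /sigma_finiteP[G [TG ndG Goo]] := sigma_finiteT mu.
exists (fun k => g @^-1` (F k `*` G k)).
  rewrite -preimage_bigcup -[LHS](preimage_setT g); congr (_ @^-1` _).
  apply/esym; rewrite -subTset => -[x y] _.
  have [k _ Fkx] : (\bigcup_k F k) x by rewrite -TF.
  have [l _ Gly] : (\bigcup_k G k) y by rewrite -TG.
  exists (maxn k l) => //; split => /=.
    by move: x Fkx; exact/subsetPset/ndF/leq_maxl.
  by move: y Gly; exact/subsetPset/ndG/leq_maxr.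
move=> k; have [mFk Fkoo] := Foo k; have [mGk Gkoo] := Goo k.
have mFG : measurable (F k `*` G k) by exact: measurableX.
split; first by rewrite -[X in measurable X]setTI; exact: mg.
rewrite /lebesgue_tuple_step /pushforward -comp_preimage.
rewrite (_ : g \o _ = id) ?preimage_id; last by apply/funext => p; exact: gK.
by rewrite product_measure1E// lte_mul_pinfty// ge0_fin_numE.
Qed.

HB.instance Definition _ := Measure_isSigmaFinite.Build _ _ _ lebesgue_tuple_step
  lebesgue_tuple_step_sigma_finite.

End Step.

Fixpoint lebesgue_tuple m :
    {sigma_finite_measure set (m.-tuple (measurableTypeR R)) -> \bar R} :=
  match m with
  | 0 => \d_[tuple]
  | k.+1 => lebesgue_tuple_step (lebesgue_tuple k)
  end.

Lemma lebesgue_tuple_box m (A : 'I_m -> set (measurableTypeR R)) :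
  (forall i, measurable (A i)) ->
  lebesgue_tuple m [set t | forall i, A i (tnth t i)] =
  \prod_(i < m) lebesgue_measure (A i).
Proof.
elim: m A => [|m IH] A mA.
  by rewrite big_ord0 /= diracE mem_set// => -[].
rewrite big_ord_recl -IH; last by move=> i; exact: mA.
rewrite /= /lebesgue_tuple_step /pushforward -product_measure1E//; last first.
  rewrite (_ : [set _ | _] =
      \bigcap_(i in [set: 'I_m]) (fun t => tnth t i) @^-1` A (lift ord0 i)).
    apply: fin_bigcap_measurable => // i _.
    by rewrite -[X in measurable X]setTI; apply: measurable_tnth.
  by apply/seteqP; split => t At i; [move=> _|]; exact: At.
congr (_ _); apply/seteqP; split => -[x t] /=.
  move=> H; split; first exact: (H ord0).
  by move=> i; have := H (lift ord0 i); rewrite tnthS.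
move=> [Ax At] i; case: (unliftP ord0 i) => [j ->|->//].
by rewrite tnthS.
Qed.

End LebesgueTuple.

Section Euclidean.
Context {R : realType}.

Definition dotp n (x y : 'cV[R]_n) : R := \sum_(i < n) x i 0 * y i 0.

Definition enorm n (x : 'cV[R]_n) : R := Num.sqrt (dotp x x).

Definition unit_sphere n : set 'cV[R]_n := [set x | enorm x = 1].

Definition cube n : set 'cV[R]_n := [set x | forall i, -1 <= x i 0 <= 1].

(* Orthogonal projection onto the hyperplane theta^perp, for a unit vector
   theta. *)
Definition proj_perp n (theta x : 'cV[R]_n) : 'cV[R]_n :=
  x - dotp x theta *: theta.

(* The columns of U form an orthonormal basis of theta^perp. *)
Definition orthonormal_basis_perp n (theta : 'cV[R]_n) (U : 'M[R]_(n, n.-1)) :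
  Prop := U^T *m U = 1%:M /\ theta^T *m U = 0.

(* Lebesgue measure of the hyperplane spanned by the orthonormal columns of U,
   transported from R^(n-1) by the isometry t |-> U t. *)
Definition hyperplane_lebesgue n (U : 'M[R]_(n, n.-1)) (A : set 'cV[R]_n) :
    \bar R :=
  lebesgue_tuple n.-1 [set t | A (U *m \col_j tnth t j)].

End Euclidean.

Notation borel_cV R n := (g_sigma_algebraType (@open 'cV[R]_n)).

Section RandomVectors.
Context {R : realType} d (Omega : measurableType d) (P : probability Omega R).
Local Open Scope ereal_scope.

(* hyperplane_lebesgue U does not depend on the chosen orthonormal basis U of
   theta^perp, so the existential is only a way of naming the measure. *)
Definition uniform_on_perp n (theta : 'cV[R]_n) (K : set 'cV[R]_n)
    (X : {RV P >-> borel_cV R n}) : Prop :=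
  exists U : 'M[R]_(n, n.-1), orthonormal_basis_perp theta U /\
    forall A : set (borel_cV R n), measurable A ->
      distribution P X A =
      hyperplane_lebesgue U (A `&` K) / hyperplane_lebesgue U K.

(* The lambda_Z^2 of a centered random vector Z. *)
Definition lambda_sq n (Z : Omega -> 'cV[R]_n) : \bar R :=
  ereal_sup [set 'E_P[fun w => (dotp (Z w) xi ^+ 2)%R] | xi in @unit_sphere R n].

End RandomVectors.

(* Main.v *)
Require Import Defs.
From HB Require Import structures.
From mathcomp Require Import all_boot all_order all_algebra.
From mathcomp Require Import all_classical all_reals all_analysis.
From mathcomp Require Import measurable_realfun ring lra.

Set Implicit Arguments.
Unset Strict Implicit.
Unset Printing Implicit Defensive.

Import Order.TTheory GRing.Theory Num.Theory.
Import numFieldNormedType.Exports.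

Local Open Scope classical_set_scope.
Local Open Scope ring_scope.

(** Write n = m + 1, let P be the orthogonal projection onto the hyperplane and
    s_i the sign of theta_i. A line directed by theta that meets the cube leaves
    it through a facet y_i = s_i with theta_i <> 0, and almost every such line
    through only one of them. So the shadow P [-1, 1]^n is, up to null sets, the
    disjoint union of the projections of these facets, and X is a mixture: draw
    a facet i with probability p_i, fill the other m positions with independent
    uniform coordinates in [-1, 1], and project ([ge0_integral_hcoord]). The
    weights p_i enter below only through p_i >= 0 and sum_i p_i = 1, so no
    determinant has to be computed: the map from the hyperplane to the i-th facet
    sends Lebesgue measure to a translation-invariant measure, and such a measure
    is a multiple of Lebesgue measure ([translation_invariant_unique]).

    Put z_a = T P e_a and G_ab = <z_a, z_b>, so that |TX|^2 = sum_ab G_ab y_a y_b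
    for a random point y of the cube's boundary. Given the facet i, its mean is
    tr G / 3 + (2 / 3) G_ii, and its variance is at most 2 sum_ab G_ab^2 by a
    moment computation on the cube ([cubeE_quad_sqr_le]). Averaging over i,
      E |TX|^2   = tr G / 3 + (2 / 3) sum_i p_i G_ii,
      Var |TX|^2 <= (4 / 9) sum_i p_i G_ii^2 + 2 sum_ab G_ab^2.

    On the other hand, given the facet, the coordinates of y are orthogonal and
    have second moments 1 / 3 or 1, so
    lambda^2 |xi|^2 >= E <TX, xi>^2 >= (1 / 3) sum_a <z_a, xi>^2 for every xi.
    Taking xi = z_b gives sum_a G_ab^2 <= 3 lambda^2 G_bb, hence also
    G_bb^2 <= 3 lambda^2 G_bb. Inserted in the bound for the variance, this
    yields the constant 18 ([mixture_variance_le]). *)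

(** * Translation invariance of the iterated Lebesgue measure *)

Section Translation.
Context {R : realType}.
Local Notation mu := (@lebesgue_measure R).
Local Notation mR := (measurableTypeR R).
Local Open Scope ereal_scope.

Definition tadd m (v t : m.-tuple mR) : m.-tuple mR :=
  [tuple (tnth v i + tnth t i : R)%R | i < m].

Lemma measurable_tadd2 m :
  measurable_fun setT (fun p : m.-tuple mR * m.-tuple mR => tadd p.1 p.2).
Proof.
apply/measurable_fun_tnthP => i.
rewrite (_ : _ \o _ = (fun p => (tnth p.1 i + tnth p.2 i)%R : R)); last first.
  by apply/funext => p /=; rewrite tnth_mktuple.
apply: measurable_funD.
  exact: (measurableT_comp (measurable_tnth i) measurable_fst).
exact: (measurableT_comp (measurable_tnth i) measurable_snd).
Qed.

Lemma measurable_tadd m (v : m.-tuple mR) : measurable_fun setT (tadd v).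
Proof.
exact: (measurableT_comp (@measurable_tadd2 m) (pair1_measurable v)).
Qed.

Lemma measurable_addl (a : R) :
  measurable_fun [set: mR] ((fun x => a + x)%R : mR -> mR).
Proof. by apply: measurable_funD => //; exact: measurable_cst. Qed.

Lemma lebesgue_measureD (a : R) (A : set mR) : measurable A ->
  pushforward mu ((fun x => a + x)%R : mR -> mR) A = mu A.
Proof.
move=> mA; apply/esym/lebesgue_measure_unique => //=.
  exact: measurable_addl.
move=> _ _ [[x y]] _ <-.
rewrite /= /pushforward (_ : _ @^-1` _ = `](x - a)%R, (y - a)%R]%classic).
  rewrite !lebesgue_measure_itv/= !lte_fin ltrD2r; case: ifP => // _.
  by rewrite -!EFinB; congr (_%:E); ring.
by apply/seteqP; split => z /=; rewrite !in_itv /= ltrBlDl lerBrDl.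
Qed.

Lemma ge0_integral_lebesgueD (a : R) (f : mR -> \bar R) :
  measurable_fun setT f -> (forall x, 0 <= f x) ->
  \int[mu]_x f (a + x)%R = \int[mu]_x f x.
Proof.
move=> mf f0.
rewrite -[LHS](ge0_integral_pushforward (measurable_addl a) mu measurableT)//.
by apply: eq_measure_integral => [|? A mA _];
  [exact: measurable_addl|exact: lebesgue_measureD].
Qed.

Lemma lebesgue_tupleS m (A : set (m.+1.-tuple mR)) :
  lebesgue_tuple m.+1 A =
  \int[mu]_x lebesgue_tuple m [set t | A (tuple_cons (x, t))].
Proof.
rewrite /= /lebesgue_tuple_step /pushforward /product_measure1.
apply: eq_integral => x _ /=; congr (lebesgue_tuple m _).
by apply/seteqP; split => t; rewrite /xsection /= inE.
Qed.

Lemma tadd_cons m (v : m.+1.-tuple mR) x t :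
  tadd v (tuple_cons (x, t)) =
  tuple_cons ((thead v + x)%R, tadd [tuple of behead v] t).
Proof.
case/tupleP: v => v0 v.
rewrite (_ : [tuple of behead [tuple of v0 :: v]] = v :> m.-tuple mR);
  last exact: val_inj.
rewrite theadE /tuple_cons /=; apply: eq_from_tnth => i; rewrite tnth_mktuple.
by case: (unliftP ord0 i) => [j ->|->]; rewrite ?tnthS ?tnth_mktuple ?tnth0.
Qed.

(** Slice along the first coordinate: the translation moves the slicing variable,
    which the one-dimensional case undoes, and moves each slice, which the
    induction hypothesis undoes. *)
Lemma lebesgue_tupleD m (v : m.-tuple mR) (A : set (m.-tuple mR)) :
  measurable A -> lebesgue_tuple m (tadd v @^-1` A) = lebesgue_tuple m A.
Proof.
elim: m v A => [|m IH] v A mA.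
  rewrite (_ : tadd v = id) ?preimage_id//.
  by apply/funext => t; rewrite [tadd v t]tuple0 [t in RHS]tuple0.
have mcons : measurable ((@tuple_cons R m) @^-1` A).
  by rewrite -[X in measurable X]setTI; apply: measurable_tuple_cons.
rewrite !lebesgue_tupleS.
rewrite -[RHS](ge0_integral_lebesgueD (thead v)) //; first last.
  pose B := (@tuple_cons R m) @^-1` A.
  rewrite (_ : (fun _ => _) = lebesgue_tuple m \o xsection B).
    exact: measurable_fun_xsection.
  apply/funext => x /=; congr (lebesgue_tuple m _).
  by apply/seteqP; split => t; rewrite /xsection /= inE.
apply: eq_integral => x _.
rewrite -[RHS](IH [tuple of behead v]).
  congr (lebesgue_tuple m _); apply/funext => t; congr (A _).
  exact: tadd_cons.
rewrite (_ : [set t | _] = xsection ((@tuple_cons R m) @^-1` A) (thead v + x)%R).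
  exact: measurable_xsection.
by apply/seteqP; split => t; rewrite /xsection /= inE.
Qed.

End Translation.

(** * Translation-invariant measures are multiples of Lebesgue measure *)

Section SigmaFiniteCopy.
Context d (T : measurableType d) (R : realType).
Variables (nu : {measure set T -> \bar R}) (sf : sigma_finite setT nu).

(** The same measure with its sigma-finiteness made canonical, so that it can be
    a factor of a product measure. *)
Definition sigma_finite_copy of sigma_finite setT nu : set T -> \bar R := nu.
HB.instance Definition _ := Measure.copy (sigma_finite_copy sf) nu.
HB.instance Definition _ :=
  Measure_isSigmaFinite.Build _ _ _ (sigma_finite_copy sf) sf.
End SigmaFiniteCopy.

Section Uniqueness.
Context {R : realType}.
Local Notation mR := (measurableTypeR R).
Local Open Scope ereal_scope.

Definition tcube (m : nat) : set (m.-tuple mR) :=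
  [set t | forall i, (-1 <= (tnth t i : R) <= 1)%R].
Arguments tcube : clear implicits.

Lemma measurable_tbox m (A : 'I_m -> set mR) : (forall i, measurable (A i)) ->
  measurable [set t : m.-tuple mR | forall i, A i (tnth t i)].
Proof.
move=> mA; rewrite (_ : [set _ | _] =
    \bigcap_(i in [set: 'I_m]) (fun t => tnth t i) @^-1` A i).
  apply: fin_bigcap_measurable => // i _.
  by rewrite -[X in measurable X]setTI; apply: measurable_tnth.
by apply/seteqP; split => t At i; [move=> _|]; exact: At.
Qed.

Lemma tcubeE (m : nat) :
  tcube m = [set t : m.-tuple mR | forall i, `[(-1)%R, 1%R]%classic (tnth t i : R)].
Proof. by apply/seteqP; split => t Qt i; have := Qt i; rewrite /= in_itv. Qed.

Lemma measurable_tcube m : measurable (tcube m).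
Proof. by rewrite tcubeE; exact: (@measurable_tbox _ (fun=> `[(-1)%R, 1%R]%classic)). Qed.

Lemma lebesgue_tcube m : lebesgue_tuple m (tcube m) = (2 ^+ m)%:E.
Proof.
rewrite tcubeE (lebesgue_tuple_box (A := fun=> `[(-1)%R, 1%R]%classic))//.
rewrite (eq_bigr (fun=> 2%:E)); last first.
  move=> i _; rewrite lebesgue_measure_itv /= lte_fin ifT; last lra.
  by rewrite -EFinB; congr EFin; lra.
by rewrite prodEFin big_const_ord iter_mulr_1.
Qed.

Lemma lebesgue_tcube_lty m : lebesgue_tuple m (tcube m) < +oo.
Proof. by rewrite lebesgue_tcube ltry. Qed.

Lemma lebesgue_tuple_coord_eq0 (m : nat) (i : 'I_m) (c : R) :
  lebesgue_tuple m [set t : m.-tuple mR | tnth t i = c :> R] = 0.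
Proof.
pose A j := if j == i then [set c : mR] else [set: mR].
rewrite (_ : [set _ | _] = [set t | forall j, A j (tnth t j)]).
  rewrite lebesgue_tuple_box /A; last by move=> j; case: ifP.
  by rewrite (bigD1 i)//= eqxx lebesgue_measure_set1 mul0e.
apply/seteqP; split => t /= H; first by move=> j; rewrite /A; case: eqP => // ->.
by have := H i; rewrite /A eqxx.
Qed.

Definition topp m (t : m.-tuple mR) : m.-tuple mR :=
  [tuple (- tnth t i)%R : R | i < m].

Lemma measurable_topp m : measurable_fun setT (@topp m).
Proof.
apply/measurable_fun_tnthP => i.
rewrite (_ : _ \o _ = (fun p => (- tnth p i)%R : R)); last first.
  by apply/funext => p /=; rewrite tnth_mktuple.
by apply: measurable_funN; exact: measurable_tnth.
Qed.

Lemma taddC m (x y : m.-tuple mR) : tadd x y = tadd y x.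
Proof. by apply: eq_from_tnth => i; rewrite !tnth_mktuple addrC. Qed.

Lemma taddKN m (x y : m.-tuple mR) : tadd (topp x) (tadd x y) = y.
Proof. by apply: eq_from_tnth => i; rewrite !tnth_mktuple addKr. Qed.

Lemma topp_tadd_topp m (x y : m.-tuple mR) :
  topp (tadd (topp x) y) = tadd (topp y) x.
Proof. by apply: eq_from_tnth => i; rewrite !tnth_mktuple opprD opprK addrC. Qed.

Lemma tcube_topp m (t : m.-tuple mR) : tcube m t -> tcube m (topp t).
Proof. by move=> Qt i; rewrite tnth_mktuple; have := Qt i; lra. Qed.

Section Translates.
Variables (m : nat) (nu : {measure set (m.-tuple mR) -> \bar R}).
Hypothesis nuD : forall v A, measurable A -> nu (tadd v @^-1` A) = nu A.
Hypothesis nuQ : nu (tcube m) < +oo.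

(** The integer translates of the cube are countably many, cover the space, and
    all have the finite measure of the cube. *)
Lemma translation_invariant_sigma_finite : sigma_finite setT nu.
Proof.
pose F k := if unpickle k is Some z then
  tadd [tuple (- (tnth z i)%:~R)%R : R | i < m] @^-1` tcube m else set0.
exists F.
  apply/esym; rewrite -subTset => t _.
  exists (pickle [tuple Num.floor (tnth t i : R) | i < m]) => //.
  rewrite /F pickleK => i; rewrite !tnth_mktuple.
  have := floor_le (tnth t i : R); have := floorD1_gt (tnth t i : R).
  rewrite intrD; lra.
move=> k; rewrite /F; case: unpickle => [z|]; last by rewrite measure0.
split; last by rewrite nuD//; exact: measurable_tcube.
by rewrite -[X in measurable X]setTI; apply: measurable_tadd => //;
  exact: measurable_tcube.
Qed.

(** Compute in two ways the product measure of the pairs (x, y) with x in the cube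
    and x + y in B. For fixed x the y-slice is a translate of B. For fixed y,
    translating the x-slice by y turns the set into the pairs (z, y) with z in B
    and z - y in the cube; as the cube is symmetric, the y-slice at z is then a
    translate of the cube. *)
Lemma translation_invariant_unique B : measurable B ->
  (2 ^+ m)%:E * nu B = nu (tcube m) * lebesgue_tuple m B.
Proof.
move=> mB.
have mQ := @measurable_tcube m.
pose nu' : {sigma_finite_measure set (m.-tuple mR) -> \bar R} :=
  sigma_finite_copy translation_invariant_sigma_finite.
pose L := @lebesgue_tuple R m.
pose E : set (m.-tuple mR * m.-tuple mR) :=
  [set p | tcube m p.1 /\ B (tadd p.1 p.2)].
pose E' : set (m.-tuple mR * m.-tuple mR) :=
  [set p | B p.1 /\ tcube m (tadd (topp p.2) p.1)].
have mE : measurable E.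
  rewrite (_ : E = (tcube m `*` setT) `&`
      (fun p => tadd p.1 p.2) @^-1` B); last by apply/seteqP; split => p /= []//; case.
  apply: measurableI; first exact: measurableX.
  by rewrite -[X in measurable X]setTI; apply: measurable_tadd2.
have mE' : measurable E'.
  rewrite (_ : E' = (B `*` setT) `&`
      (fun p => tadd (topp p.2) p.1) @^-1` tcube m);
    last by apply/seteqP; split => p /= []//; case.
  apply: measurableI; first exact: measurableX.
  rewrite -[X in measurable X]setTI.
  have mg : measurable_fun setT (fun p : m.-tuple mR * m.-tuple mR =>
      (topp p.2, p.1)).
    apply: measurable_fun_pair => //.
    exact: (measurableT_comp (@measurable_topp m) measurable_snd).
  exact: (measurableT_comp (@measurable_tadd2 R m) mg).
have prodE (X : set (m.-tuple mR * m.-tuple mR)) : measurable X ->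
    \int[L]_x nu' (xsection X x) = \int[nu']_y L (ysection X y).
  move=> mX; apply: (@product_measure_unique _ _ _ _ R L nu' (L \x^ nu')) => //.
  by move=> A1 A2 mA1 mA2; exact: product_measure2E.
transitivity (\int[L]_x nu' (xsection E x)).
  rewrite -(lebesgue_tcube m) muleC.
  rewrite (eq_integral (fun x => (\1_(tcube m) x)%:E * nu B)); last first.
    move=> x _; rewrite indicE.
    have [xQ|xQ] := boolP (x \in tcube m); last first.
      rewrite mul0e; rewrite (_ : xsection E x = set0) ?measure0//.
      by rewrite -subset0 => y; rewrite /xsection /E/= inE /=
        => -[]/mem_set; rewrite (negbTE xQ).
    rewrite mul1e -[RHS](nuD x)//; congr (nu _).
    apply/seteqP; split => y; rewrite /xsection /E/= inE/= => //; first by case.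
    by move=> ?; split => //; exact: set_mem.
  rewrite ge0_integralZr//; last exact: measurableT_comp.
  by rewrite integral_indic// setIT muleC.
rewrite prodE//.
transitivity (\int[nu']_y L (ysection E' y)).
  apply: eq_integral => y _.
  rewrite -[RHS](lebesgue_tupleD y); last exact: measurable_ysection.
  congr (L _); apply/seteqP; split => x;
    rewrite /ysection /E /E' /= !inE /=.
  - move=> [xQ yB]; by rewrite taddKN taddC.
  - by rewrite taddKN taddC => -[].
rewrite -prodE//.
rewrite (eq_integral (fun x => (\1_B x)%:E * nu (tcube m))).
  rewrite ge0_integralZr//; last exact: measurableT_comp.
  by rewrite integral_indic// setIT muleC.
move=> x _; rewrite indicE.
have [xB|xB] := boolP (x \in B); last first.
  rewrite mul0e; rewrite (_ : xsection E' x = set0) ?measure0//.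
  by rewrite -subset0 => y; rewrite /xsection /E'/= inE /=
    => -[]/mem_set; rewrite (negbTE xB).
rewrite mul1e -[RHS](nuD (topp x))//.
congr (nu _).
apply/seteqP; split => y; rewrite /xsection /E'/= inE/=.
  by move=> [_ /tcube_topp]; rewrite topp_tadd_topp.
by move=> H; split; [exact: set_mem|rewrite -topp_tadd_topp; exact: tcube_topp].
Qed.
End Translates.
End Uniqueness.
Arguments tcube {R} m.

(** * Integrating out one coordinate of the cube *)

Section Moments.
Context {R : realType}.
Local Notation mu := (@lebesgue_measure R).
Local Notation mR := (measurableTypeR R).

Lemma integral_deriv_poly (p : {poly R}) (a b : R) : a < b ->
  (\int[mu]_(x in `[a, b]) (p^`().[x])%:E = (p.[b] - p.[a])%:E)%E.
Proof.
move=> ab; rewrite (@continuous_FTC2 _ (horner p^`()) (horner p)) ?EFinB//.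
- by apply: continuous_subspaceT => x; exact: continuous_horner.
- split; first by move=> x _; exact: derivable_horner.
  + by apply: cvg_at_right_filter; exact: continuous_horner.
  + by apply: cvg_at_left_filter; exact: continuous_horner.
- by move=> x _; rewrite derivE.
Qed.

(** Degree four is the degree of the square of a quadratic polynomial. *)
Lemma integral_quartic (a b c d e : R) :
  (\int[mu]_(x in `[(-1)%R, 1%R])
     (a + b * x + c * x ^+ 2 + d * x ^+ 3 + e * x ^+ 4)%:E
   = (2 * (a + c / 3 + e / 5))%:E)%E.
Proof.
pose mono (k : nat) (z : R) : {poly R} := (z / k.+1%:R) *: 'X^(k.+1).
have mono_deriv k z x : (mono k z)^`().[x] = z * x ^+ k.
  rewrite derivZ derivXn hornerZ hornerMn hornerXn -(mulr_natl (x ^+ k)).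
  by rewrite mulrA divfK ?pnatr_eq0.
pose p := mono 0%N a + mono 1%N b + mono 2%N c + mono 3%N d + mono 4%N e.
transitivity (\int[mu]_(x in `[(-1)%R, 1%R]) (p^`().[x])%:E)%E.
  apply: eq_integral => x _; congr EFin.
  by rewrite /p !derivD !hornerD !mono_deriv expr0 expr1 mulr1.
rewrite integral_deriv_poly; last lra.
congr EFin; rewrite /p !hornerD !hornerZ !hornerXn !expr1n.
rewrite !exprS expr0; lra.
Qed.

(** Measurable, and bounded on the cube: a class closed under sums and products
    on which integration over the cube is linear and Fubini's theorem applies. *)
Definition bmfun m (f : m.-tuple mR -> R) :=
  measurable_fun setT f /\ exists M, forall t, tcube m t -> `|f t| <= M.

Lemma bmfun_cst m (c : R) : bmfun (fun _ : m.-tuple mR => c).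
Proof. by split; [exact: measurable_cst|exists `|c|]. Qed.

Lemma bmfunD m (f g : m.-tuple mR -> R) :
  bmfun f -> bmfun g -> bmfun (fun t => f t + g t).
Proof.
move=> [mf [M fM]] [mg [N gN]]; split; first exact: measurable_funD.
exists (M + N) => t Qt.
by rewrite (le_trans (ler_normD _ _))// lerD ?fM ?gN.
Qed.

Lemma bmfunM m (f g : m.-tuple mR -> R) :
  bmfun f -> bmfun g -> bmfun (fun t => f t * g t).
Proof.
move=> [mf [M fM]] [mg [N gN]]; split; first exact: measurable_funM.
by exists (M * N) => t Qt; rewrite normrM ler_pM ?fM ?gN.
Qed.

Lemma bmfun_tnth m (i : 'I_m) : bmfun (fun t => tnth t i : R).
Proof.
split; first exact: measurable_tnth.
by exists 1 => t Qt; rewrite ler_norml; exact: Qt.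
Qed.

Lemma bmfun_sum m n (f : 'I_n -> m.-tuple mR -> R) :
  (forall i, bmfun (f i)) -> bmfun (fun t => \sum_i f i t).
Proof.
move=> bf; suff H (s : seq 'I_n) : bmfun (fun t => \sum_(i <- s) f i t) by exact: H.
elim: s => [|i s IH].
  under eq_fun do rewrite big_nil; exact: bmfun_cst.
under eq_fun do rewrite big_cons; exact: bmfunD.
Qed.

Lemma bmfunX m (f : m.-tuple mR -> R) k : bmfun f -> bmfun (fun t => f t ^+ k).
Proof.
move=> bf; elim: k => [|k IH].
  under eq_fun do rewrite expr0; exact: bmfun_cst.
under eq_fun do rewrite exprS; exact: bmfunM.
Qed.

Lemma bmfun_integrable m (f : m.-tuple mR -> R) : bmfun f ->
  (lebesgue_tuple m).-integrable (tcube m) (EFin \o f).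
Proof.
move=> [mf [M fM]]; apply: measurable_bounded_integrable.
- exact: measurable_tcube.
- exact: lebesgue_tcube_lty.
- exact: measurable_funTS.
- exists M; split; first exact: num_real.
  by move=> x Mx t Qt; apply: le_trans (ltW Mx); exact: fM.
Qed.

(** The mean of f for the uniform law on the cube. *)
Definition cubeE m (f : m.-tuple mR -> R) : R :=
  (2 ^+ m)^-1 * \int[lebesgue_tuple m]_(t in tcube m) f t.

Lemma cubeED m (f g : m.-tuple mR -> R) : bmfun f -> bmfun g ->
  cubeE (fun t => f t + g t) = cubeE f + cubeE g.
Proof.
move=> bf bg; rewrite /cubeE RintegralD ?mulrDr//; last 2 first.
- exact: bmfun_integrable.
- exact: bmfun_integrable.
- exact: measurable_tcube.
Qed.

Lemma cubeEZ m (c : R) (f : m.-tuple mR -> R) : bmfun f ->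
  cubeE (fun t => c * f t) = c * cubeE f.
Proof.
move=> bf; rewrite /cubeE RintegralZl 1?mulrCA//.
  exact: measurable_tcube.
exact: bmfun_integrable.
Qed.

Lemma cubeE_cst m (c : R) : cubeE (fun _ : m.-tuple mR => c) = c.
Proof.
rewrite /cubeE Rintegral_cst; last exact: measurable_tcube.
have -> : fine (@lebesgue_tuple R m (tcube m)) = 2 ^+ m.
  by rewrite lebesgue_tcube.
by rewrite mulrCA mulVf ?mulr1 ?expf_neq0.
Qed.

Lemma cubeE0 (f : 0.-tuple mR -> R) : cubeE f = f [tuple].
Proof.
rewrite -[RHS](cubeE_cst 0); congr (_ * _); apply: eq_Rintegral => t _.
by rewrite (tuple0 t).
Qed.

Lemma EFin_cubeE m (f : m.-tuple mR -> R) : bmfun f ->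
  (\int[lebesgue_tuple m]_(t in tcube m) (f t)%:E = (2 ^+ m * cubeE f)%:E)%E.
Proof.
move=> bf; rewrite /cubeE mulrA divff ?mul1r ?expf_neq0//.
by rewrite fineK//; apply: integrable_fin_num (bmfun_integrable bf);
  exact: measurable_tcube.
Qed.

Lemma tcube_cons m (x : mR) t :
  tcube m.+1 (tuple_cons (x, t)) <-> `[-1, 1]%classic (x : R) /\ tcube m t.
Proof.
rewrite /= in_itv /=; split => [H|[x1 Qt] i].
  split; first by have := H ord0; rewrite tnth0.
  by move=> i; have := H (lift ord0 i); rewrite tnthS.
by case: (unliftP ord0 i) => [j ->|->]; rewrite ?tnthS ?tnth0.
Qed.

(** Fubini, integrating out the first coordinate x: the odd powers of x have
    mean 0, and x^2 and x^4 have means 1 / 3 and 1 / 5. *)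
Lemma cubeE_quartic m (f : m.+1.-tuple mR -> R) (a b c d e : m.-tuple mR -> R) :
  bmfun f -> bmfun a -> bmfun c -> bmfun e ->
  (forall x t, f (tuple_cons (x, t)) = a t + b t * x + c t * x ^+ 2 +
    d t * x ^+ 3 + e t * x ^+ 4) ->
  cubeE f = cubeE (fun t => a t + c t / 3 + e t / 5).
Proof.
move=> bf ba bc be fE.
have bg : bmfun (fun t => a t + c t / 3 + e t / 5).
  by apply: bmfunD; [apply: bmfunD => //|]; apply: bmfunM => //; exact: bmfun_cst.
have [mf [M fM]] := bf.
suff H : (\int[lebesgue_tuple m.+1]_(t in tcube m.+1) (f t)%:E =
  \int[lebesgue_tuple m]_(t in tcube m) (2 * (a t + c t / 3 + e t / 5))%:E)%E.
  move: H; rewrite (EFin_cubeE bf) (EFin_cubeE (bmfunM (bmfun_cst _ 2) bg)).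
  rewrite cubeEZ// mulrA -exprSr => -[]; apply: mulfI.
  by rewrite expf_neq0.
have mcons := @measurable_tuple_cons R m.
have mQ := @measurable_tcube R m.+1.
pose D := (@tuple_cons R m) @^-1` tcube m.+1.
have mD : measurable D.
  by rewrite -[X in measurable X]setTI; exact: (mcons measurableT _ mQ).
have ifD : (mu \x lebesgue_tuple m)%E.-integrable D
    ((EFin \o f) \o @tuple_cons R m).
  rewrite -[X in _.-integrable _ X]/(EFin \o (f \o @tuple_cons R m)).
  apply: measurable_bounded_integrable.
  - exact: mD.
  - exact: (lebesgue_tcube_lty m.+1).
  - exact/measurable_funTS/measurableT_comp.
  - exists M; split; first exact: num_real.
    by move=> x Mx t Qt; apply: le_trans (ltW Mx); exact: fM.
rewrite [LHS](integral_pushforward mcons) //; last exact/measurable_EFinP.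
rewrite integral_mkcond -integral21_prod_meas1; last first.
  by apply/(integrable_mkcond _ mD).
rewrite [RHS]integral_mkcond; apply: eq_integral => t _.
rewrite /fubini_G patchE; have [tQ|tQ] := boolP (t \in tcube m); last first.
  apply: integral0_eq => x _; rewrite patchE ifF//; apply/negbTE.
  by apply: contra tQ; rewrite !inE => /tcube_cons[].
rewrite -(integral_quartic _ (b t) _ (d t)) [RHS]integral_mkcond.
apply: eq_integral => x _; rewrite !patchE (_ : (_ \in D) = (x \in `[(-1)%R, 1%R]%classic)) /=.
  by case: ifP => // _; rewrite fE.
apply/idP/idP; rewrite !inE; first by move=> /tcube_cons[].
by move=> xI; apply/tcube_cons; split => //; exact: set_mem.
Qed.
End Moments.

(** * Moments of quadratic polynomials on the cube *)

Section Quad.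
Context {R : realType}.
Local Notation mR := (measurableTypeR R).

Definition affine m (b : 'I_m -> R) (c : R) (t : m.-tuple mR) : R :=
  \sum_j b j * (tnth t j : R) + c.

Definition quad m (A : 'I_m -> 'I_m -> R) (b : 'I_m -> R) (c : R)
    (t : m.-tuple mR) : R :=
  \sum_j \sum_k A j k * (tnth t j * tnth t k : R) + affine b c t.

Lemma bmfun_affine m (b : 'I_m -> R) c : bmfun (affine b c).
Proof.
apply: bmfunD; last exact: bmfun_cst.
by apply: bmfun_sum => j; apply: bmfunM; [exact: bmfun_cst|exact: bmfun_tnth].
Qed.

Lemma bmfun_quad m (A : 'I_m -> 'I_m -> R) b c : bmfun (quad A b c).
Proof.
apply: bmfunD; last exact: bmfun_affine.
apply: bmfun_sum => j; apply: bmfun_sum => k; apply: bmfunM; first exact: bmfun_cst.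
by apply: bmfunM; exact: bmfun_tnth.
Qed.

(** Makes the mean of the square of an affine function an instance of the mean of
    a quadratic polynomial. *)
Lemma affine_sqr m (b : 'I_m -> R) c t : affine b c t ^+ 2 =
  quad (fun j k => b j * b k) (fun j => 2 * c * b j) (c ^+ 2) t.
Proof.
rewrite /quad /affine sqrrD [RHS]addrA; congr (_ + _ + _).
  rewrite expr2 mulr_suml; apply: eq_bigr => j _; rewrite mulr_sumr.
  by apply: eq_bigr => k _; rewrite mulrACA.
rewrite mulr_suml -sumrMnl; apply: eq_bigr => j _.
by rewrite -mulr_natl; ring.
Qed.

Lemma quad_cons m (A : 'I_m.+1 -> 'I_m.+1 -> R) b c (x : R) t :
  quad A b c (tuple_cons (x, t)) =
  A ord0 ord0 * x ^+ 2 +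
  affine (fun j => A ord0 (lift ord0 j) + A (lift ord0 j) ord0) (b ord0) t * x +
  quad (fun j k => A (lift ord0 j) (lift ord0 k)) (fun j => b (lift ord0 j)) c t.
Proof.
pose B j := \sum_k A (lift ord0 j) (lift ord0 k) * (tnth t j * tnth t k : R).
have row0 : \sum_k A ord0 k * (tnth (tuple_cons (x, t)) ord0 *
    tnth (tuple_cons (x, t)) k : R) =
    A ord0 ord0 * x ^+ 2 + (\sum_j A ord0 (lift ord0 j) * (tnth t j : R)) * x.
  rewrite big_ord_recl !tnth0 expr2; congr (_ + _).
  by rewrite mulr_suml; apply: eq_bigr => j _; rewrite tnthS (mulrC x) mulrA.
have rowS : \sum_j \sum_k A (lift ord0 j) k *
    (tnth (tuple_cons (x, t)) (lift ord0 j) * tnth (tuple_cons (x, t)) k : R) =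
    (\sum_j A (lift ord0 j) ord0 * (tnth t j : R)) * x + \sum_j B j.
  rewrite mulr_suml -big_split; apply: eq_bigr => j _.
  rewrite big_ord_recl tnthS tnth0 /B /=; congr (_ + _); first by rewrite mulrA.
  by apply: eq_bigr => k _; rewrite tnthS.
have lin : \sum_j b j * (tnth (tuple_cons (x, t)) j : R) =
    b ord0 * x + \sum_j b (lift ord0 j) * (tnth t j : R).
  by rewrite big_ord_recl tnth0; congr (_ + _); apply: eq_bigr => j _; rewrite tnthS.
have mid : \sum_j (A ord0 (lift ord0 j) + A (lift ord0 j) ord0) * (tnth t j : R) =
    \sum_j A ord0 (lift ord0 j) * (tnth t j : R) +
    \sum_j A (lift ord0 j) ord0 * (tnth t j : R).
  by rewrite -big_split; apply: eq_bigr => j _; rewrite mulrDl.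
rewrite /quad /affine big_ord_recl row0 rowS lin mid -/(B _).
set s1 := \sum_j A ord0 _ * _; set s2 := \sum_j A _ ord0 * _.
set s3 := \sum_j b _ * _; set s4 := \sum_j B j.
rewrite -/s4; ring.
Qed.

Lemma cubeE_quad m (A : 'I_m -> 'I_m -> R) b c :
  cubeE (quad A b c) = (\sum_j A j j) / 3 + c.
Proof.
elim: m A b c => [|m IH] A b c.
  by rewrite cubeE0 /quad /affine !big_ord0 mul0r add0r.
pose A' j k := A (lift ord0 j) (lift ord0 k).
pose b' j := b (lift ord0 j).
pose l := affine (fun j => A ord0 (lift ord0 j) + A (lift ord0 j) ord0) (b ord0).
rewrite (@cubeE_quartic _ _ _ (quad A' b' c) l (fun=> A ord0 ord0) (fun=> 0) (fun=> 0));
  [|exact: bmfun_quad|exact: bmfun_quad|exact: bmfun_cst|exact: bmfun_cst|]; last first.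
  by move=> x t; rewrite quad_cons -/A' -/b' -/l; ring.
rewrite mul0r; under eq_fun do rewrite addr0.
rewrite cubeED; [|exact: bmfun_quad|exact: bmfun_cst].
by rewrite cubeE_cst IH big_ord_recl mulrDl /A'; ring.
Qed.

(** The variance of q is at most 2 sum A_jk^2 + sum b_j^2. Induction on m: with x
    the first coordinate, q = A_00 x^2 + l x + q' where l is affine and q'
    quadratic in the others. Averaging over x, the variance of q exceeds that of q'
    by A_00^2 (1 / 5 - 1 / 9) + E l^2 / 3, and
    E l^2 = sum_j (A_0j + A_j0)^2 / 3 + b_0^2. *)
Lemma cubeE_quad_sqr_le m (A : 'I_m -> 'I_m -> R) b c :
  cubeE (fun t => quad A b c t ^+ 2) <=
  cubeE (quad A b c) ^+ 2 + 2 * (\sum_j \sum_k A j k ^+ 2) + \sum_j b j ^+ 2.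
Proof.
elim: m A b c => [|m IH] A b c.
  by rewrite !cubeE0 !big_ord0 mulr0 !addr0.
pose A' j k := A (lift ord0 j) (lift ord0 k).
pose b' j := b (lift ord0 j).
pose a j := A ord0 (lift ord0 j) + A (lift ord0 j) ord0.
pose l := affine a (b ord0).
pose q := quad A' b' c.
have bq : bmfun q := bmfun_quad _ _ _.
have bl : bmfun l := bmfun_affine _ _.
pose A0 := A ord0 ord0.
rewrite (@cubeE_quartic _ _ _ (fun t => q t ^+ 2) (fun t => 2 * l t * q t)
    (fun t => l t ^+ 2 + 2 * A0 * q t) (fun t => 2 * A0 * l t) (fun=> A0 ^+ 2));
  first last.
- by move=> x t; rewrite quad_cons -/A' -/b' -/l -/A0 -/q; ring.
- exact: bmfun_cst.
- by apply: bmfunD; [exact: bmfunX|apply: bmfunM => //; exact: bmfun_cst].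
- exact: bmfunX.
- by apply: bmfunX; exact: bmfun_quad.
rewrite (_ : (fun t => _) =
    (fun t => q t ^+ 2 + (3^-1 * l t ^+ 2 + (2 / 3 * A0 * q t + A0 ^+ 2 / 5))));
  last first.
  by apply/funext => t; ring.
have b3 : bmfun (fun t => 2 / 3 * A0 * q t) by apply: bmfunM => //; exact: bmfun_cst.
have b1 := bmfunD b3 (bmfun_cst m (A0 ^+ 2 / 5)).
have b2 : bmfun (fun t => 3^-1 * l t ^+ 2).
  by apply: bmfunM; [exact: bmfun_cst|exact: bmfunX].
rewrite (cubeED (bmfunX 2 bq) (bmfunD b2 b1)) (cubeED b2 b1) (cubeEZ _ (bmfunX 2 bl)).
rewrite (cubeED b3 (bmfun_cst m _)) (cubeEZ _ bq) cubeE_cst.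
rewrite (_ : (fun t => l t ^+ 2) =
    quad (fun j k => a j * a k) (fun j => 2 * b ord0 * a j) (b ord0 ^+ 2));
  last first.
  by apply/funext => t; exact: affine_sqr.
have := IH A' b' c; rewrite -/q !cubeE_quad.
have -> : \sum_j A j j = A0 + \sum_j A' j j by rewrite big_ord_recl.
have -> : \sum_j b j ^+ 2 = b ord0 ^+ 2 + \sum_j b' j ^+ 2 by rewrite big_ord_recl.
have -> : \sum_j \sum_k A j k ^+ 2 =
    A0 ^+ 2 + \sum_j A ord0 (lift ord0 j) ^+ 2 +
    (\sum_j A (lift ord0 j) ord0 ^+ 2 + \sum_j \sum_k A' j k ^+ 2).
  rewrite !big_ord_recl; congr (_ + _).
  rewrite -big_split; apply: eq_bigr => i _; exact: big_ord_recl.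
have : \sum_j a j * a j <= 2 * (\sum_i A ord0 (lift ord0 i) ^+ 2) +
   2 * (\sum_i A (lift ord0 i) ord0 ^+ 2).
  rewrite !mulr_sumr -big_split; apply: ler_sum => i _ /=.
  rewrite -subr_ge0 (_ : _ - _ =
    (A ord0 (lift ord0 i) - A (lift ord0 i) ord0) ^+ 2) ?sqr_ge0//.
  by rewrite /a; ring.
have : 0 <= \sum_j a j * a j by apply: sumr_ge0 => j _; rewrite -expr2 sqr_ge0.
set sa := \sum_j a j * a j; set s1 := \sum_j A ord0 _ ^+ 2.
set s2 := \sum_j A _ ord0 ^+ 2; set s3 := \sum_j \sum_k A' j k ^+ 2.
set s4 := \sum_j b' j ^+ 2; set S := \sum_j A' j j.
move=> sa0 sa_le.
have s4_0 : 0 <= s4 by apply: sumr_ge0 => j _; exact: sqr_ge0.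
have := sqr_ge0 A0; have := sqr_ge0 (b ord0).
set T := cubeE _; clearbody S T sa s1 s2 s3 s4; move: sa0 sa_le s4_0.
clear; move: (b ord0) => b0; clearbody A0.
nra.
Qed.
End Quad.

(** * Euclidean preliminaries *)

Section EuclideanLemmas.
Context {R : realType}.

Lemma dotpC n (x y : 'cV[R]_n) : dotp x y = dotp y x.
Proof. by apply: eq_bigr => i _; rewrite mulrC. Qed.

Lemma dotp_ge0 n (x : 'cV[R]_n) : 0 <= dotp x x.
Proof. by apply: sumr_ge0 => i _; rewrite -expr2 sqr_ge0. Qed.

Lemma dotp_eq0 n (x : 'cV[R]_n) : dotp x x = 0 -> x = 0.
Proof.
move/eqP; rewrite psumr_eq0; last by move=> i _; rewrite -expr2 sqr_ge0.
move=> /allP H; apply/colP => i; apply/eqP; rewrite mxE.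
by have := H i (mem_index_enum i); rewrite mulf_eq0 orbb.
Qed.

Lemma dotpZr n (c : R) (x y : 'cV[R]_n) : dotp x (c *: y) = c * dotp x y.
Proof. by rewrite mulr_sumr; apply: eq_bigr => i _; rewrite mxE mulrCA. Qed.

Lemma dotp0r n (x : 'cV[R]_n) : dotp x 0 = 0.
Proof. by rewrite /dotp big1// => i _; rewrite mxE mulr0. Qed.

Lemma dotp_suml n (I : finType) (c : I -> R) (x : I -> 'cV[R]_n) y :
  dotp (\sum_i c i *: x i) y = \sum_i c i * dotp (x i) y.
Proof.
rewrite /dotp; under eq_bigr do rewrite summxE mulr_suml.
rewrite exchange_big; apply: eq_bigr => i _; rewrite mulr_sumr.
by apply: eq_bigr => j _; rewrite mxE mulrA.
Qed.

Lemma dotp_mulmx n (x y : 'cV[R]_n) : x^T *m y = (dotp x y)%:M.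
Proof.
apply/rowP => i; rewrite !ord1 !mxE eqxx mulr1n.
by apply: eq_bigr => j _; rewrite mxE.
Qed.

Lemma enorm_sqr n (x : 'cV[R]_n) : enorm x ^+ 2 = dotp x x.
Proof. by rewrite sqr_sqrtr// dotp_ge0. Qed.

Lemma normalize_unit_sphere n (x : 'cV[R]_n) : 0 < dotp x x ->
  unit_sphere ((enorm x)^-1 *: x).
Proof.
move=> x0; rewrite /unit_sphere /= {1}/enorm dotpZr dotpC dotpZr -enorm_sqr.
have e0 : enorm x != 0 by rewrite gt_eqF// sqrtr_gt0.
by rewrite expr2 mulKf// mulVf// sqrtr1.
Qed.

Lemma col_sum_delta n (x : 'cV[R]_n) : x = \sum_a x a 0 *: delta_mx a 0.
Proof.
apply/colP => b; rewrite summxE (bigD1 b)//= big1 ?addr0.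
  by rewrite !mxE !eqxx mulr1.
by move=> a ab; rewrite !mxE eq_sym (negbTE ab) mulr0.
Qed.

End EuclideanLemmas.

(** * Lifting the hyperplane to the facets of the cube *)

Section Facets.
Context {R : realType}.
Local Notation mR := (measurableTypeR R).
Variables (m : nat) (theta : 'cV[R]_m.+1) (U : 'M[R]_(m.+1, m)).
Hypothesis theta1 : unit_sphere theta.
Hypothesis UU : U^T *m U = 1%:M.
Hypothesis thetaU : theta^T *m U = 0.

Definition colt (t : m.-tuple mR) : 'cV[R]_m := \col_j tnth t j.
Definition tcol (x : 'cV[R]_m) : m.-tuple mR := [tuple x j 0 : R | j < m].

Lemma coltK t : tcol (colt t) = t.
Proof. by apply: eq_from_tnth => i; rewrite tnth_mktuple mxE. Qed.

Lemma tcolK x : colt (tcol x) = x.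
Proof. by apply/colP => i; rewrite mxE tnth_mktuple. Qed.

Lemma colt_tadd x y : colt (tadd x y) = colt x + colt y.
Proof. by apply/colP => i; rewrite !mxE tnth_mktuple. Qed.

Lemma theta_dotp1 : dotp theta theta = 1.
Proof. by rewrite -enorm_sqr (_ : enorm theta = 1) ?expr1n. Qed.

Lemma trU_theta : U^T *m theta = 0.
Proof. by apply: trmx_inj; rewrite trmx_mul trmxK thetaU trmx0. Qed.

(** The square matrix with columns theta and U is orthogonal, so its two Gram
    matrices are both the identity. *)
Lemma mul_U_trU y : U *m (U^T *m y) = proj_perp theta y.
Proof.
have VV : (row_mx theta U)^T *m row_mx theta U = 1%:M.
  rewrite tr_row_mx mul_col_row dotp_mulmx theta_dotp1 UU thetaU trU_theta.
  by rewrite -scalar_mx_block.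
have UE : theta *m theta^T + U *m U^T = 1%:M.
  by rewrite -mul_row_col -tr_row_mx; exact: (@mulmx1C R m.+1 _ _ VV).
have -> : U *m (U^T *m y) = 1%:M *m y - theta *m theta^T *m y.
  by rewrite -UE mulmxDl addrAC subrr add0r mulmxA.
by rewrite mul1mx -mulmxA dotp_mulmx mul_mx_scalar dotpC.
Qed.

(** The sign of the facet orthogonal to e_i through which a line directed by theta
    leaves the cube. The value 1 at theta_i = 0 keeps the square equal to 1. *)
Definition facet_sign i : R := if 0 <= theta i 0 then 1 else -1.
Local Notation s := facet_sign.

Lemma facet_sign_norm i : s i * theta i 0 = `|theta i 0|.
Proof.
rewrite /s; case: ifPn => [/ger0_norm ->|]; first by rewrite mul1r.
by rewrite -ltNge mulN1r => /ltr0_norm ->.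
Qed.

Lemma facet_sign_sqr i : s i * s i = 1.
Proof. by rewrite /s; case: ifP => _; rewrite ?mul1r// mulrNN mul1r. Qed.

(** The intersection of the line U t + R theta with the hyperplane y_i = s_i. *)
Definition facet_lift i (t : m.-tuple mR) : 'cV[R]_m.+1 :=
  U *m colt t + ((s i - (U *m colt t) i 0) / theta i 0) *: theta.

Definition facet_point (c : R) (i : 'I_m.+1) (v : m.-tuple mR) : 'cV[R]_m.+1 :=
  \col_a oapp (fun j => tnth v j : R) c (unlift i a).

(** Coordinates of the lifted point on the i-th facet; inverse to facet_proj when
    theta_i <> 0. *)
Definition facet_coord i (t : m.-tuple mR) : m.-tuple mR :=
  [tuple facet_lift i t (lift i j) 0 : R | j < m].

Definition facet_proj i (v : m.-tuple mR) : m.-tuple mR :=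
  tcol (U^T *m facet_point (s i) i v).

Lemma facet_point_lift c i v j : facet_point c i v (lift i j) 0 = tnth v j.
Proof. by rewrite mxE liftK. Qed.

Lemma facet_point_id c i v : facet_point c i v i 0 = c.
Proof. by rewrite mxE unlift_none. Qed.

Lemma facet_lift_id i t : theta i 0 != 0 -> facet_lift i t i 0 = s i.
Proof. by move=> ti; rewrite !mxE divfK// addrC subrK. Qed.

Lemma facet_coordK i t : theta i 0 != 0 ->
  facet_point (s i) i (facet_coord i t) = facet_lift i t.
Proof.
move=> ti; apply/colP => a; case: (unliftP i a) => [j ->|->].
  by rewrite facet_point_lift tnth_mktuple.
by rewrite facet_point_id facet_lift_id.
Qed.

Lemma facet_projK i t : theta i 0 != 0 -> facet_proj i (facet_coord i t) = t.
Proof.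
move=> ti; rewrite /facet_proj facet_coordK// mulmxDr mulmxA UU mul1mx.
by rewrite -scalemxAr trU_theta scaler0 addr0 coltK.
Qed.

Lemma facet_proj_perp i v :
  U *m colt (facet_proj i v) = proj_perp theta (facet_point (s i) i v).
Proof. by rewrite tcolK mul_U_trU. Qed.

Lemma tcube_facet_coord i t : theta i 0 != 0 ->
  tcube m (facet_coord i t) <-> cube (facet_lift i t).
Proof.
move=> ti; split=> [Q a|Q j]; last by rewrite tnth_mktuple; exact: Q.
case: (unliftP i a) => [j ->|->]; first by have := Q j; rewrite tnth_mktuple.
rewrite facet_lift_id// /s; case: ifP => _; lra.
Qed.

Lemma facet_lift_tadd i (e : 'cV[R]_m.+1) t : theta i 0 != 0 -> e i 0 = 0 ->
  facet_lift i (tadd (tcol (U^T *m e)) t) = e + facet_lift i t.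
Proof.
move=> ti ei0; rewrite /facet_lift colt_tadd tcolK mulmxDr mul_U_trU /proj_perp.
move: (U *m colt t) (dotp e theta) => u al.
apply/colP => a; rewrite !mxE ei0; field.
exact: ti.
Qed.

(** Every translation of the facet is induced by a translation of the hyperplane:
    the one by the projection of the translation vector, since moving along theta
    does not change the lifted point. *)
Lemma facet_coord_tadd i v t : theta i 0 != 0 ->
  facet_coord i (tadd (tcol (U^T *m facet_point 0 i v)) t) =
  tadd v (facet_coord i t).
Proof.
move=> ti; apply: eq_from_tnth => j.
rewrite tnth_mktuple facet_lift_tadd ?facet_point_id//.
by rewrite [LHS]mxE facet_point_lift !tnth_mktuple.
Qed.

Definition facet_height i t := (s i - (U *m colt t) i 0) / theta i 0.

Lemma facet_liftE i t a :
  facet_lift i t a 0 = (U *m colt t) a 0 + facet_height i t * theta a 0.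
Proof. by rewrite /facet_lift /facet_height; move: (U *m _) => u; rewrite !mxE. Qed.

(** As long as the line is inside the slab |y_i| <= 1, it has not yet passed the
    facet hyperplane y_i = s_i, because s_i y_i increases along theta. *)
Lemma facet_height_le i t x : theta i 0 != 0 ->
  ((U *m colt t) i 0 + x * theta i 0 : R) \in `[-1, 1] -> x <= facet_height i t.
Proof.
move=> ti xI.
have : s i * ((U *m colt t) i 0 + x * theta i 0) <=
       s i * ((U *m colt t) i 0 + facet_height i t * theta i 0).
  rewrite -facet_liftE facet_lift_id//; move: xI; rewrite in_itv /= /s.
  by case: ifP => _; lra.
rewrite !mulrDr lerD2l !(mulrCA (s i)) facet_sign_norm ler_pM2r//.
by rewrite normr_gt0.
Qed.

(** If both lifted points lie in the cube, each of the two heights bounds the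
    other, so the two lifted points coincide; this point is then on both facets. *)
Lemma facet_overlap i k j t : theta i 0 != 0 -> theta k 0 != 0 ->
  k = lift i j -> tcube m (facet_coord i t) -> tcube m (facet_coord k t) ->
  tnth (facet_coord i t) j = s k.
Proof.
move=> ti tk kij /(tcube_facet_coord _ ti) Qi /(tcube_facet_coord _ tk) Qk.
have rik : facet_height i t = facet_height k t.
  apply/eqP; rewrite eq_le !facet_height_le// -facet_liftE in_itv /=.
    exact: Qk.
  exact: Qi.
by rewrite tnth_mktuple -kij facet_liftE rik -facet_liftE facet_lift_id.
Qed.

(** Starting from a point of the cube above t and moving along theta, the first
    facet hyperplane y_i = s_i that is reached is reached inside the cube. *)
Lemma shadow_facets t :
  (proj_perp theta @` @cube R m.+1) (U *m colt t) <->
  exists2 i, theta i 0 != 0 & tcube m (facet_coord i t).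
Proof.
have tr (y : 'cV[R]_m.+1) : U^T *m y = colt t -> proj_perp theta y = U *m colt t.
  by move=> <-; rewrite mul_U_trU.
split; last first.
  move=> [i ti /(tcube_facet_coord _ ti) Q]; exists (facet_lift i t) => //.
  apply: tr; rewrite -[in RHS](facet_projK t ti) tcolK.
  by rewrite facet_coordK.
move=> [x Qx xE].
pose al := dotp x theta.
have {}xE a : x a 0 = (U *m colt t) a 0 + al * theta a 0.
  by rewrite -xE !mxE subrK.
have [i0 ti0] : exists i0, theta i0 0 != 0.
  apply: contrapT => H; move: theta_dotp1; rewrite /dotp big1.
    by move/esym/eqP; rewrite oner_eq0.
  by move=> i _; have [->|ti] := eqVneq (theta i 0) 0; [rewrite mul0r|case: H; exists i].
have [i ti imin] := @Order.TotalTheory.arg_minP _ _ _ i0 (fun i => theta i 0 != 0)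
   (fun i => facet_height i t) ti0.
exists i => //; apply/tcube_facet_coord => // a.
have ali : al <= facet_height i t.
  by apply: facet_height_le => //; rewrite -xE in_itv /=; exact: Qx.
have := Qx a; rewrite facet_liftE xE.
have [->|ta] := eqVneq (theta a 0) 0; first by rewrite !mulr0.
have := imin a ta.
have := facet_lift_id t ta; rewrite facet_liftE.
have [t_gt0|t_le0] := ltrP 0 (theta a 0).
  by rewrite /s ltW//; nra.
have t_lt0 : theta a 0 < 0 by rewrite lt_neqAle ta.
have /negbTE s_neg : ~~ (0 <= theta a 0) by rewrite -ltNge.
by rewrite /s s_neg; nra.
Qed.

Lemma measurable_linear_tuple n (f : m.-tuple mR -> n.-tuple mR)
    (A : 'I_n -> 'I_m -> R) (b : 'I_n -> R) :
  (forall t j, tnth (f t) j = affine (A j) (b j) t) -> measurable_fun setT f.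
Proof.
move=> fE; apply/measurable_fun_tnthP => j.
rewrite (_ : _ \o _ = affine (A j) (b j)); first exact: (bmfun_affine _ _).1.
by apply/funext => t /=; rewrite fE.
Qed.

Lemma measurable_facet_coord i : measurable_fun setT (facet_coord i).
Proof.
pose A j k := U (lift i j) k - U i k / theta i 0 * theta (lift i j) 0.
apply: (@measurable_linear_tuple _ _ A (fun j => s i / theta i 0 * theta (lift i j) 0)).
move=> t j; rewrite tnth_mktuple facet_liftE /facet_height /affine.
rewrite mulrBl mulrBl !mxE addrCA addrC; congr (_ + _).
rewrite -!mulrA mulr_suml -sumrB; apply: eq_bigr => k _.
by rewrite !mxE /A mulrBl; ring.
Qed.

Lemma measurable_facet_proj i : measurable_fun setT (facet_proj i).
Proof.
apply: (@measurable_linear_tuple _ _ (fun j k => U (lift i k) j) (fun j => U i j * s i)).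
move=> t j; rewrite tnth_mktuple !mxE (bigD1_ord i)//= mxE facet_point_id addrC.
congr (_ + _); apply: eq_bigr => k _.
by rewrite mxE facet_point_lift.
Qed.
End Facets.

(** * The shadow of the cube as an essentially disjoint union of facets *)

Section MeasureLemmas.
Local Open Scope ereal_scope.
Context d (T : measurableType d) (R : realType).
Variable mu : {measure set T -> \bar R}.

Lemma measureU_null (A B : set T) : measurable A -> measurable B ->
  mu (A `&` B) = 0 -> mu (A `|` B) = mu A + mu B.
Proof.
move=> mA mB AB0.
have -> : A `|` B = A `|` (B `\` A).
  apply/seteqP; split => t [|]; [by left| |by left|by case; right].
  by move=> Bt; have [At|At] := pselect (A t); [left|right].
rewrite measureU; [|by []|exact: measurableD|by rewrite setDIK].
have -> : mu B = mu (B `\` A) + mu (A `&` B) by rewrite setIC; exact: measureDI.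
by rewrite AB0 adde0.
Qed.

Lemma measure_bigsetU_null (I : eqType) (s : seq I) (F : I -> set T) :
  uniq s -> (forall i, measurable (F i)) ->
  (forall i j, i != j -> mu (F i `&` F j) = 0) ->
  mu (\big[setU/set0]_(i <- s) F i) = \sum_(i <- s) mu (F i).
Proof.
move=> us mF F0; elim: s us => [|i s IH] /=; first by rewrite !big_nil measure0.
move=> /andP[is_ us]; rewrite !big_cons measureU_null ?IH//.
  exact: bigsetU_measurable.
have {IH us}: forall j, j \in s -> i != j.
  by move=> j js; apply: contra is_ => /eqP ->.
elim: s {is_} => [|j s IH] H; first by rewrite big_nil setI0 measure0.
rewrite big_cons setIUr measureU0 ?F0 ?H ?mem_head//.
- exact: measurableI.
- by apply: measurableI => //; exact: bigsetU_measurable.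
- by apply: IH => k ks; apply: H; rewrite inE ks orbT.
Qed.

Lemma ge0_integral_mrestr (D : set T) (mD : measurable D) (f : T -> \bar R) :
  measurable_fun setT f -> (forall x, 0 <= f x) ->
  \int[mrestr mu mD]_x f x = \int[mu]_(x in D) f x.
Proof.
move=> mf f0.
rewrite (@ge0_negligible_integral _ _ _ _ setT (~` D))//; last 2 first.
- exact: measurableC.
- by rewrite /= /mrestr setICl measure0.
rewrite setTD setCK; apply: eq_measure_integral => A mA AD.
by rewrite /= /mrestr setIidl.
Qed.

End MeasureLemmas.

Section Mixture.
Context {R : realType}.
Local Notation mR := (measurableTypeR R).
Variables (m : nat) (theta : 'cV[R]_m.+1) (U : 'M[R]_(m.+1, m)).
Hypothesis theta1 : unit_sphere theta.
Hypothesis UU : U^T *m U = 1%:M.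
Hypothesis thetaU : theta^T *m U = 0.
Local Notation L := (@lebesgue_tuple R m).
Local Notation Q := (@tcube R m).
Local Notation phi := (facet_coord theta U).
Local Notation chi := (facet_proj theta U).
Local Open Scope ereal_scope.

Definition shadow : set (m.-tuple mR) :=
  [set t | (proj_perp theta @` @cube R m.+1) (U *m colt t)].

Definition facet_shadow i : set (m.-tuple mR) :=
  if (theta i 0 != 0)%R then phi i @^-1` Q else set0.

Lemma measurable_facet_shadow i : measurable (facet_shadow i).
Proof.
rewrite /facet_shadow; case: ifP => // _; rewrite -[X in measurable X]setTI.
by apply: measurable_facet_coord => //; exact: measurable_tcube.
Qed.

Lemma shadowE : shadow = \big[setU/set0]_i facet_shadow i.
Proof.
rewrite -bigcup_seq; apply/seteqP; split => t.
  move=> /(shadow_facets theta1 UU thetaU)[i ti Qi]; exists i => //=.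
    by rewrite mem_index_enum.
  by rewrite /facet_shadow ti.
move=> [i _]; rewrite /facet_shadow; case: ifP => // ti Qi.
by apply/(shadow_facets theta1 UU thetaU); exists i.
Qed.

Lemma measurable_shadow : measurable shadow.
Proof.
by rewrite shadowE; apply: bigsetU_measurable => i _;
  exact: measurable_facet_shadow.
Qed.

Hypothesis shadow_fin : L shadow < +oo.

Lemma facet_shadow_lty i : L (facet_shadow i) < +oo.
Proof.
apply: le_lt_trans shadow_fin; apply: le_measure; rewrite ?inE.
- exact: measurable_facet_shadow.
- exact: measurable_shadow.
- rewrite shadowE -bigcup_seq => t Pt; exists i => //=.
  by rewrite mem_index_enum.
Qed.

(** Translation invariance of the image measure on the facet comes from that of
    Lebesgue measure on the hyperplane; uniqueness of invariant measures then gives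
    proportionality, with the measure of the facet's shadow as the factor. *)
Lemma pushforward_facet_coord i B : (theta i 0 != 0)%R -> measurable B ->
  (2 ^+ m)%:E * L (phi i @^-1` B) = L (facet_shadow i) * L B.
Proof.
move=> ti mB.
have mphi := measurable_facet_coord theta U i.
have Pi : facet_shadow i = phi i @^-1` Q by rewrite /facet_shadow ti.
rewrite Pi.
have := @translation_invariant_unique R m
  (measure_function_pushforward__canonical__measure_function_Measure L mphi).
apply => //=; last by have := facet_shadow_lty i; rewrite Pi.
move=> v A mA; rewrite /pushforward.
rewrite -[RHS](lebesgue_tupleD (tcol (U^T *m facet_point 0 i v)%R)); last first.
  by rewrite -[X in measurable X]setTI; exact: mphi.
congr (L _); apply/funext => t /=.
by rewrite facet_coord_tadd.
Qed.

Lemma measurable_facet_proj_preimage i B : measurable B ->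
  measurable (chi i @^-1` B).
Proof.
move=> mB; rewrite -[X in measurable X]setTI.
exact: (measurable_facet_proj theta U i).
Qed.

Lemma facet_shadow_law i B : measurable B ->
  (2 ^+ m)%:E * L (facet_shadow i `&` B) = L (facet_shadow i) * L (Q `&` chi i @^-1` B).
Proof.
move=> mB; have [ti|ti] := boolP (theta i 0 != 0)%R; last first.
  by rewrite /facet_shadow (negbTE ti) set0I measure0 mule0 mul0e.
rewrite -pushforward_facet_coord//; last first.
  by apply: measurableI; [exact: measurable_tcube|exact: measurable_facet_proj_preimage].
congr (_ * L _); rewrite /facet_shadow ti.
by apply/seteqP; split => t /=; rewrite facet_projK.
Qed.

Lemma pow2_mule_eq0 (x : \bar R) : (2 ^+ m)%:E * x = 0 -> x = 0.
Proof.
by move/eqP; rewrite mule_eq0 eqe expf_eq0 pnatr_eq0 andbF /= => /eqP.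
Qed.

(** Seen on the i-th facet, an overlap lies in the null set where one coordinate is
    constant. *)
Lemma facet_shadow_overlap i k : i != k -> L (facet_shadow i `&` facet_shadow k) = 0.
Proof.
move=> ik; have [ti|ti] := boolP (theta i 0 != 0)%R; last first.
  by rewrite /facet_shadow (negbTE ti) set0I measure0.
have [tk|tk] := boolP (theta k 0 != 0)%R; last first.
  by rewrite /facet_shadow (negbTE tk) setI0 measure0.
case: (unliftP i k) ik => [j kE _|->]; last by rewrite eqxx.
pose N : set (m.-tuple mR) := [set v | tnth v j = facet_sign theta k :> R].
have mN : measurable N.
  rewrite (_ : N = (fun v => tnth v j) @^-1` [set facet_sign theta k : mR])//.
  by rewrite -[X in measurable X]setTI; apply: measurable_tnth.
have mphi := measurable_facet_coord theta U i.
apply: (@subset_measure0 _ _ _ _ _ (phi i @^-1` N)).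
- by apply: measurableI; exact: measurable_facet_shadow.
- by rewrite -[X in measurable X]setTI; exact: mphi.
- move=> t; rewrite /facet_shadow ti tk => -[Qi Qk].
  exact: facet_overlap kE Qi Qk.
- apply: pow2_mule_eq0.
  by rewrite pushforward_facet_coord// lebesgue_tuple_coord_eq0 mule0.
Qed.

Lemma shadow_law B : measurable B ->
  L (shadow `&` B) = \sum_i L (facet_shadow i `&` B).
Proof.
move=> mB; rewrite shadowE (big_distrl B)/=.
apply: measure_bigsetU_null.
- exact: index_enum_uniq.
- by move=> i; apply: measurableI => //; exact: measurable_facet_shadow.
- move=> i k ik; apply: (@subset_measure0 _ _ _ _ _ (facet_shadow i `&` facet_shadow k)).
  + by do 2 apply: measurableI => //; exact: measurable_facet_shadow.
  + by apply: measurableI; exact: measurable_facet_shadow.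
  + by move=> t [[? _] [? _]].
  + exact: facet_shadow_overlap.
Qed.

Hypothesis shadow_gt0 : 0 < L shadow.

(** The mass that the uniform law on the shadow gives to the part under facet i. *)
Definition weight i : R := (fine (L (facet_shadow i)) / fine (L shadow))%R.

Lemma weight_ge0 i : (0 <= weight i)%R.
Proof. by rewrite /weight divr_ge0// fine_ge0. Qed.

Lemma fine_shadow_gt0 : (0 < fine (L shadow))%R.
Proof. by rewrite fine_gt0// shadow_gt0 shadow_fin. Qed.

Lemma sum_weight : (\sum_i weight i = 1)%R.
Proof.
have := shadow_law measurableT; rewrite setIT.
under eq_bigr do rewrite setIT.
rewrite -mulr_suml; move=> /(congr1 fine) H.
rewrite [X in (X / _)%R](_ : _ = fine (L shadow)) ?divff ?gt_eqF ?fine_shadow_gt0//.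
rewrite H sum_fine// => i _; rewrite ge0_fin_numE ?measure_ge0//; exact: facet_shadow_lty.
Qed.

(** The uniform law on the shadow as the mixture, with these weights, of the images
    under facet_proj of the uniform law on the cube; 2^m normalises the latter. *)
Lemma shadow_cond_law B : measurable B ->
  L (shadow `&` B) / L shadow =
  \sum_i (weight i / 2 ^+ m)%:E * L (Q `&` chi i @^-1` B).
Proof.
move=> mB; rewrite shadow_law//.
have Lfin : L shadow \is a fin_num by rewrite ge0_fin_numE.
rewrite -[in X in _ / X](fineK Lfin) inver gt_eqF ?fine_shadow_gt0//.
rewrite ge0_sume_distrl//; apply: eq_bigr => i _.
have two_neq0 : (2 ^+ m != 0 :> R)%R by rewrite expf_neq0.
have -> : L (facet_shadow i `&` B) =
    ((2 ^+ m)^-1)%:E * (L (facet_shadow i) * L (Q `&` chi i @^-1` B)).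
  by rewrite -facet_shadow_law// muleA -EFinM mulVf// mul1e.
have Pfin : L (facet_shadow i) \is a fin_num by rewrite ge0_fin_numE// facet_shadow_lty.
rewrite -[in LHS](fineK Pfin) /weight muleA -EFinM muleAC -EFinM.
by congr (_%:E * _); ring.
Qed.

End Mixture.

(** * Expectations as mixtures over the facets *)

Section CoordMeasurable.
Context {R : realType}.

Lemma measurable_borel_coord n (b : 'I_n) :
  measurable_fun [set: borel_cV R n] (fun x : 'cV[R]_n => x b 0 : R).
Proof.
apply: (measurability _ (RGenOpens.measurableE R)).
move=> _ [_ [a [c ->] <-]]; rewrite setTI; apply: sub_sigma_algebra.
have /continuousP := @coord_continuous R n 1 b 0.
by apply; exact: interval_open.
Qed.

(** Stated for all parametrisations g, so that one hypothesis covers both the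
    composition with the random vector and that with the coordinates of the
    hyperplane. *)
Definition coord_measurable n (f : 'cV[R]_n -> R) :=
  forall d (S : measurableType d) (g : S -> 'cV[R]_n),
    (forall b, measurable_fun setT (fun w => g w b 0 : R)) ->
    measurable_fun setT (f \o g).

End CoordMeasurable.

Section Expectation.
Context {R : realType} (m : nat) (theta : 'cV[R]_m.+1).
Variables (d : measure_display) (Omega : measurableType d)
  (P : probability Omega R) (X : {RV P >-> borel_cV R m.+1}).
Local Notation mR := (measurableTypeR R).
Local Notation L := (@lebesgue_tuple R m).
Local Notation Q := (@tcube R m).
Hypothesis theta1 : unit_sphere theta.
Variable U : 'M[R]_(m.+1, m).
Hypothesis UU : U^T *m U = 1%:M.
Hypothesis thetaU : theta^T *m U = 0.
Local Open Scope ereal_scope.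
Let K := proj_perp theta @` @cube R m.+1.
Hypothesis XK : forall A : set (borel_cV R m.+1), measurable A ->
  distribution P X A =
  @hyperplane_lebesgue R m.+1 U (A `&` K) / @hyperplane_lebesgue R m.+1 U K.
Local Notation chi := (facet_proj theta U).
Local Notation p := (weight theta U).

Lemma hyperplane_lebesgue_shadow : @hyperplane_lebesgue R m.+1 U K = L (shadow theta U).
Proof. by []. Qed.

(** In the extended reals 0 / 0 and +oo / +oo are both 0, so a quotient of the
    measure of the shadow by itself equal to 1 excludes these two values. *)
Lemma shadow_nondegenerate : 0 < L (shadow theta U) < +oo.
Proof.
have x0 : 0 <= L (shadow theta U) by exact: measure_ge0.
have : 1 = L (shadow theta U) / L (shadow theta U).
  have := XK measurableT; rewrite setTI hyperplane_lebesgue_shadow => <-.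
  by rewrite probability_setT.
move: x0; case: (L (shadow theta U)) => [r r0||//].
  rewrite ltry andbT lt_neqAle r0 andbT => H; apply/eqP => r00.
  by move: H; rewrite -r00 mul0e => /eqP; rewrite onee_eq0.
by move=> _; rewrite invey mule0 => /eqP; rewrite onee_eq0.
Qed.

(** The coordinates of X in the orthonormal basis U. *)
Definition hcoord (w : Omega) : m.-tuple mR := tcol (U^T *m X w)%R.

Lemma measurable_tcol_mul d' (S : measurableType d') (g : S -> 'cV[R]_m.+1) :
  (forall b, measurable_fun setT (fun w => g w b 0%R : R)) ->
  measurable_fun setT (fun w => tcol (U^T *m g w)%R : m.-tuple mR).
Proof.
move=> mg; apply/measurable_fun_tnthP => j.
rewrite (_ : _ \o _ = (fun w => (\sum_b U b j * g w b 0)%R)); last first.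
  by apply/funext => w /=; rewrite tnth_mktuple mxE; apply: eq_bigr => b _; rewrite mxE.
apply: measurable_sum => b; apply: measurable_funM => //.
Qed.

Lemma measurable_Xcoord b : measurable_fun setT (fun w => X w b 0%R : R).
Proof.
exact: (measurableT_comp (@measurable_borel_coord R m.+1 b) (measurable_funP X)).
Qed.

Lemma measurable_hcoord : measurable_fun setT hcoord.
Proof. by apply: measurable_tcol_mul => b; exact: measurable_Xcoord. Qed.

Lemma hcoord_law B : measurable B ->
  P (hcoord @^-1` B) = L (shadow theta U `&` B) / L (shadow theta U).
Proof.
move=> mB.
pose A : set (borel_cV R m.+1) := (fun x => tcol (U^T *m x)%R) @^-1` B.
have mA : measurable A.
  rewrite -[X in measurable X]setTI.
  by apply: (@measurable_tcol_mul _ (borel_cV R m.+1) id) => // b;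
    exact: measurable_borel_coord.
have := XK mA; rewrite hyperplane_lebesgue_shadow /distribution /pushforward => ->.
congr (L _ / _); apply/seteqP; split => t /=;
  rewrite /A /K /= -/(colt t) mulmxA UU mul1mx coltK.
  by case.
by case.
Qed.

(** The law of X charges only theta^perp, on which U U^T is the identity. *)
Lemma ae_hcoordK : {ae P, forall w, X w = U *m colt (hcoord w) :> 'cV[R]_m.+1}.
Proof.
pose A : set (borel_cV R m.+1) := (fun x => dotp x theta) @^-1` [set 0%R : mR].
have mA : measurable A.
  rewrite -[X in measurable X]setTI.
  have : measurable_fun setT (fun x : borel_cV R m.+1 => dotp x theta : mR).
    by apply: measurable_sum => b; apply: measurable_funM => //;
      exact: measurable_borel_coord.
  by apply.
have PA : P (X @^-1` A) = 1.
  rewrite -[LHS]/(distribution P X A) XK// (_ : A `&` K = K).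
    by rewrite hyperplane_lebesgue_shadow; have := XK measurableT;
      rewrite setTI probability_setT => <-.
  apply/seteqP; split => x; first by case.
  move=> Kx; split=> //; case: Kx => y _ <-.
  rewrite /A /= /proj_perp /dotp.
  rewrite (eq_bigr (fun i =>
    y i 0 * theta i 0 - dotp y theta * (theta i 0 * theta i 0)))%R.
    by rewrite sumrB -mulr_sumr -/(dotp theta theta) theta_dotp1// mulr1 subrr.
  by move=> i _; rewrite !mxE mulrBl mulrA.
have mXA : measurable (X @^-1` A).
  by rewrite -[X in measurable X]setTI; exact: (measurable_funP X).
exists (~` (X @^-1` A)); split.
- exact: measurableC.
- by rewrite probability_setC// PA subee.
- move=> w; apply: contra_not => /= XA.
  by rewrite /hcoord tcolK (mul_U_trU theta1)// /proj_perp XA scale0r subr0.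
Qed.

(** The mixture representation of X, in coordinates. *)
Lemma ge0_integral_hcoord (F : m.-tuple mR -> R) :
  measurable_fun setT F -> (forall t, 0 <= F t)%R ->
  (forall i, bmfun (F \o chi i)) ->
  \int[P]_w (F (hcoord w))%:E = (\sum_i p i * cubeE (F \o chi i))%:E.
Proof.
move=> mF F0 bF.
have /andP[s0 soo] := shadow_nondegenerate.
have mQ := @measurable_tcube R m.
have mchi k := measurable_facet_proj theta U (inord k).
have c0 k : (0 <= p (inord k) / 2 ^+ m)%R.
  by rewrite divr_ge0 ?exprn_ge0 ?weight_ge0.
(* inord turns the family indexed by facets into a sequence of measures. *)
pose mu_ (k : nat) : {measure set (m.-tuple mR) -> \bar R} :=
  mscale (NngNum (c0 k))
  (measure_function_pushforward__canonical__measure_function_Measure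
    (mrestr L mQ) (mchi k)).
transitivity (\int[pushforward P hcoord]_t (F t)%:E).
  rewrite (ge0_integral_pushforward measurable_hcoord)//.
    exact/measurable_EFinP.
  by move=> t _; rewrite lee_fin.
transitivity (\int[msum mu_ m.+1]_t (F t)%:E).
  apply: eq_measure_integral => [|? A mA _]; first exact: measurable_hcoord.
  rewrite [LHS]hcoord_law// shadow_cond_law// /msum.
  apply: eq_bigr => i _; rewrite -[in LHS](inord_val i); congr (_ * _).
  by rewrite setIC.
have mEF : measurable_fun setT (EFin \o F) by exact/measurable_EFinP.
rewrite ge0_integral_measure_sum//; last by move=> t _; rewrite lee_fin.
rewrite -sumEFin; apply: eq_bigr => i _.
rewrite ge0_integral_mscale//; last by move=> t _; rewrite lee_fin.
rewrite ge0_integral_pushforward//; last by move=> t _; rewrite lee_fin.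
rewrite preimage_setT ge0_integral_mrestr//.
- rewrite /= inord_val (EFin_cubeE (bF i)) -EFinM.
  by congr EFin; rewrite mulrA divfK ?expf_neq0.
- exact: measurableT_comp.
- by move=> t; rewrite lee_fin.
Qed.

Lemma expectation_facets (f : 'cV[R]_m.+1 -> R) :
  coord_measurable f -> (forall x, 0 <= f x)%R ->
  (forall i, bmfun (fun v =>
    f (proj_perp theta (facet_point (facet_sign theta i) i v)))) ->
  'E_P[fun w => f (X w)] =
  (\sum_i p i * cubeE (fun v =>
    f (proj_perp theta (facet_point (facet_sign theta i) i v))))%:E.
Proof.
move=> mf f0 bf.
have E i : (fun t => f (U *m colt t)) \o chi i =
   fun v => f (proj_perp theta (facet_point (facet_sign theta i) i v)).
  by apply/funext => v /=; rewrite facet_proj_perp.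
have mcolt : measurable_fun setT (fun t : m.-tuple mR => f (U *m colt t)).
  apply: (mf _ _ (fun t : m.-tuple mR => U *m colt t)) => b.
  under eq_fun do rewrite mxE.
  apply: measurable_sum => j; apply: measurable_funM => //.
  by under eq_fun do rewrite mxE; exact: measurable_tnth.
under [in RHS]eq_bigr do rewrite -E.
rewrite -(ge0_integral_hcoord mcolt)//; last by move=> i; rewrite E.
rewrite unlock; apply: ge0_ae_eq_integral => //.
- apply/measurable_EFinP; apply: (mf _ _ X) => b; exact: measurable_Xcoord.
- by apply/measurable_EFinP; exact: (measurableT_comp mcolt measurable_hcoord).
- by move=> w _; rewrite lee_fin.
- by move=> w _; rewrite lee_fin.
- by apply: filterS ae_hcoordK => w XE _ /=; rewrite [in LHS]XE.
Qed.

End Expectation.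

(** * The variance inequality *)

Section Forms.
Context {R : realType} (m : nat).
Local Notation mR := (measurableTypeR R).
Implicit Types G : 'I_m.+1 -> 'I_m.+1 -> R.

Definition quadratic_form G (y : 'cV[R]_m.+1) : R :=
  \sum_a \sum_b G a b * (y a 0 * y b 0).

(** The mean of y^T G y when y_i = 1 or -1 and the other coordinates are
    independent and uniform in [-1, 1]. *)
Definition facet_mean G i : R := (\sum_a G a a) / 3 + 2 / 3 * G i i.

Lemma quadratic_form_facet_point G c i (v : m.-tuple mR) : c * c = 1 ->
  quadratic_form G (facet_point c i v) =
  quad (fun j k => G (lift i j) (lift i k))
       (fun j => c * (G i (lift i j) + G (lift i j) i)) (G i i) v.
Proof.
move=> cc; rewrite /quadratic_form (bigD1_ord i)//=.
have -> : \sum_b G i b * (facet_point c i v i 0 * facet_point c i v b 0) =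
    G i i + \sum_j c * G i (lift i j) * (tnth v j : R).
  rewrite (bigD1_ord i)//= facet_point_id cc mulr1; congr (_ + _).
  by apply: eq_bigr => j _; rewrite facet_point_lift mulrCA mulrA.
rewrite [X in _ + X](eq_bigr (fun j => c * G (lift i j) i * (tnth v j : R) +
    \sum_k G (lift i j) (lift i k) * (tnth v j * tnth v k : R))); last first.
  move=> j _; rewrite (bigD1_ord i)//= facet_point_id facet_point_lift.
  congr (_ + _); first by rewrite (mulrC _ c) mulrCA mulrA.
  by apply: eq_bigr => l _; rewrite facet_point_lift.
rewrite big_split /quad /affine /=.
have -> : \sum_j c * (G i (lift i j) + G (lift i j) i) * (tnth v j : R) =
    \sum_j c * G i (lift i j) * (tnth v j : R) +
    \sum_j c * G (lift i j) i * (tnth v j : R).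
  by rewrite -big_split; apply: eq_bigr => j _; rewrite mulrDr mulrDl.
by ring.
Qed.

Lemma cubeE_quadratic_form G c i : c * c = 1 ->
  cubeE (fun v => quadratic_form G (facet_point c i v)) = facet_mean G i.
Proof.
move=> cc; under eq_fun do rewrite quadratic_form_facet_point//.
rewrite cubeE_quad /facet_mean [in RHS](bigD1_ord i)//=; lra.
Qed.

(** On the facet, the row and the column i of G produce the linear coefficients
    2 c G_ij, whose squares sum to 4 sum_j G_ij^2; this is exactly the
    off-diagonal contribution of that row and column to 2 sum_ab G_ab^2. *)
Lemma cubeE_quadratic_form_dev_le G c i M : c * c = 1 -> (forall a b, G a b = G b a) ->
  cubeE (fun v => (quadratic_form G (facet_point c i v) - M) ^+ 2) <=
  (facet_mean G i - M) ^+ 2 + 2 * \sum_a \sum_b G a b ^+ 2.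
Proof.
move=> cc Gsym.
pose A j k := G (lift i j) (lift i k).
pose b j := c * (G i (lift i j) + G (lift i j) i).
have -> : (fun v => (quadratic_form G (facet_point c i v) - M) ^+ 2) =
    (fun v => quad A b (G i i - M) v ^+ 2).
  by apply/funext => v; rewrite quadratic_form_facet_point// /quad /affine !addrA.
apply: le_trans (cubeE_quad_sqr_le _ _ _) _.
rewrite cubeE_quad -addrA; apply: lerD.
  suff -> : (\sum_j A j j) / 3 + (G i i - M) = facet_mean G i - M by [].
  rewrite /facet_mean (bigD1_ord i)//= /A; lra.
have -> : \sum_j b j ^+ 2 = 4 * \sum_j G i (lift i j) ^+ 2.
  rewrite mulr_sumr; apply: eq_bigr => j _.
  by rewrite /b (Gsym _ i) exprMn expr2 cc; ring.
have -> : \sum_a \sum_b G a b ^+ 2 = G i i ^+ 2 + 2 * (\sum_j G i (lift i j) ^+ 2) +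
    \sum_j \sum_k A j k ^+ 2.
  rewrite (bigD1_ord i)//= (bigD1_ord i)//= mulr2n mulrDl mul1r -!addrA.
  congr (_ + (_ + _)); rewrite -big_split; apply: eq_bigr => j _.
  by rewrite (bigD1_ord i)//= (Gsym _ i).
have := sqr_ge0 (G i i); lra.
Qed.

(** Total variance. The facet means differ from M only through (2 / 3) G_ii, so
    their variance is at most (4 / 9) sum_i p_i G_ii^2. The hypothesis on l bounds
    this by (4 / 9) l sum_i p_i G_ii and bounds 2 sum_ab G_ab^2 by 2 l tr G,
    while 6 l M = 2 l tr G + 4 l sum_i p_i G_ii. *)
Lemma mixture_variance_le G (p : 'I_m.+1 -> R) (l M : R) :
  (forall i, 0 <= p i) -> \sum_i p i = 1 ->
  (forall b, \sum_a G a b ^+ 2 <= l * G b b) ->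
  M = \sum_i p i * facet_mean G i ->
  \sum_i p i * ((facet_mean G i - M) ^+ 2 + 2 * \sum_a \sum_b G a b ^+ 2) <= 6 * l * M.
Proof.
move=> p0 p1 Gl MDef.
pose g := \sum_i p i * G i i.
pose tr := \sum_a G a a.
have ME : M = tr / 3 + 2 / 3 * g.
  rewrite MDef (eq_bigr (fun i => tr / 3 * p i + 2 / 3 * (p i * G i i))).
    by rewrite big_split -!mulr_sumr p1 mulr1.
  by move=> i _; rewrite /facet_mean -/tr /=; ring.
have GG : \sum_a \sum_b G a b ^+ 2 <= l * tr.
  by rewrite exchange_big mulr_sumr; apply: ler_sum.
have Gii i : G i i ^+ 2 <= l * G i i.
  apply: le_trans (Gl i); rewrite (bigD1 i)//= lerDl.
  by apply: sumr_ge0 => a _; exact: sqr_ge0.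
have lg0 : 0 <= l * g.
  rewrite mulr_sumr; apply: sumr_ge0 => i _; rewrite mulrCA mulr_ge0//.
  exact: le_trans (sqr_ge0 _) (Gii i).
have pG2 : \sum_i p i * G i i ^+ 2 <= l * g.
  rewrite mulr_sumr; apply: ler_sum => i _; rewrite [leRHS]mulrCA.
  by apply: ler_wpM2l.
have -> : \sum_i p i * ((facet_mean G i - M) ^+ 2 + 2 * \sum_a \sum_b G a b ^+ 2) =
    4 / 9 * (\sum_i p i * G i i ^+ 2 - g ^+ 2) + 2 * \sum_a \sum_b G a b ^+ 2.
  set S := 2 * \sum_a _.
  rewrite (eq_bigr (fun i => 4 / 9 * (p i * G i i ^+ 2) - 8 / 9 * g * (p i * G i i) +
     (4 / 9 * g ^+ 2 + S) * p i)); last first.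
    by move=> i _; rewrite ME /facet_mean -/tr; field.
  rewrite big_split sumrB /= -!mulr_sumr p1 -/g; by field.
have := sqr_ge0 g; rewrite ME; nra.
Qed.

End Forms.

Section Final.
Context {R : realType} (m k : nat) (theta : 'cV[R]_m.+1).
Variable T : {linear 'cV[R]_m.+1 -> 'cV[R]_k}.

Definition Tperp (a : 'I_m.+1) : 'cV[R]_k := T (proj_perp theta (delta_mx a 0)).

Lemma Tperp_sum y : T (proj_perp theta y) = \sum_a y a 0 *: Tperp a.
Proof.
have -> : proj_perp theta y = \sum_a y a 0 *: proj_perp theta (delta_mx a 0).
  rewrite /proj_perp; under eq_bigr do rewrite scalerBr.
  rewrite sumrB; congr (_ - _).
    exact: col_sum_delta.
  rewrite /dotp scaler_suml; apply: eq_bigr => a _.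
  rewrite (bigD1 a)//= big1 ?addr0 ?mxE ?eqxx ?mul1r ?scalerA//.
  by move=> b ba; rewrite mxE (negbTE ba) mul0r.
by rewrite linear_sum; apply: eq_bigr => a _; rewrite linearZ.
Qed.

Lemma dotp_Tperp y xi :
  dotp (T (proj_perp theta y)) xi ^+ 2 =
  quadratic_form (fun a b => dotp (Tperp a) xi * dotp (Tperp b) xi) y.
Proof.
rewrite Tperp_sum dotp_suml expr2 mulr_suml; apply: eq_bigr => a _.
by rewrite mulr_sumr; apply: eq_bigr => b _; ring.
Qed.

Lemma dotp_Tperp_self y :
  dotp (T (proj_perp theta y)) (T (proj_perp theta y)) =
  quadratic_form (fun a b => dotp (Tperp a) (Tperp b)) y.
Proof.
rewrite {1}Tperp_sum dotp_suml; apply: eq_bigr => a _.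
rewrite dotpC Tperp_sum dotp_suml mulr_sumr; apply: eq_bigr => b _.
by rewrite dotpC; ring.
Qed.

Lemma coord_measurable_T a : coord_measurable (fun x => T x a 0).
Proof.
move=> d S g mg.
have -> : (fun x => T x a 0) \o g = (fun w => \sum_b g w b 0 * T (delta_mx b 0) a 0).
  apply/funext => w /=.
  rewrite [in LHS](col_sum_delta (g w)) linear_sum summxE; apply: eq_bigr => b _.
  by rewrite linearZ mxE.
apply: measurable_sum => b; apply: measurable_funM => //.
Qed.

Lemma coord_measurable_dotpT (xi : 'cV[R]_k) :
  coord_measurable (fun x => dotp (T x) xi).
Proof.
move=> d S g mg; apply: measurable_sum => a; apply: measurable_funM => //.
exact: coord_measurable_T.
Qed.

Lemma coord_measurable_dotpTT : coord_measurable (fun x => dotp (T x) (T x)).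
Proof.
move=> d S g mg; apply: measurable_sum => a.
by apply: measurable_funM; exact: coord_measurable_T.
Qed.

Variables (d : measure_display) (Omega : measurableType d)
  (P : probability Omega R) (X : {RV P >-> borel_cV R m.+1}).
Hypothesis theta1 : unit_sphere theta.
Variable U : 'M[R]_(m.+1, m).
Hypothesis UU : U^T *m U = 1%:M.
Hypothesis thetaU : theta^T *m U = 0.
Let K := proj_perp theta @` @cube R m.+1.
Hypothesis XK : forall A : set (borel_cV R m.+1), measurable A ->
  (distribution P X A =
  @hyperplane_lebesgue R m.+1 U (A `&` K) / @hyperplane_lebesgue R m.+1 U K)%E.
Local Notation p := (weight theta U).
Local Notation s := (facet_sign theta).

Let gram a b := dotp (Tperp a) (Tperp b).
Let M := \sum_i p i * facet_mean gram i.

Lemma bmfun_quadratic_form G i :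
  bmfun (fun v => quadratic_form G (facet_point (s i) i v)).
Proof.
under eq_fun do rewrite quadratic_form_facet_point ?facet_sign_sqr//.
exact: bmfun_quad.
Qed.

Lemma weight_sum1 : \sum_i p i = 1.
Proof.
by have /andP[? ?] := shadow_nondegenerate XK; apply: sum_weight.
Qed.

Lemma expectation_enorm_sqr :
  ('E_P[fun w => (enorm (T (X w)) ^+ 2)%R] = M%:E)%E.
Proof.
under eq_fun do rewrite enorm_sqr.
rewrite (expectation_facets theta1 UU thetaU XK (f := fun x => dotp (T x) (T x)))//.
- congr EFin; apply: eq_bigr => i _; congr (_ * _).
  under eq_fun do rewrite dotp_Tperp_self.
  by rewrite cubeE_quadratic_form ?facet_sign_sqr.
- exact: coord_measurable_dotpTT.
- by move=> x; exact: dotp_ge0.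
- by move=> i; under eq_fun do rewrite dotp_Tperp_self; exact: bmfun_quadratic_form.
Qed.

Lemma expectation_dotp_sqr xi :
  ('E_P[fun w => (dotp (T (X w)) xi ^+ 2)%R] =
  (\sum_i p i * facet_mean (fun a b => dotp (Tperp a) xi * dotp (Tperp b) xi) i)%R%:E)%E.
Proof.
rewrite (expectation_facets theta1 UU thetaU XK (f := fun x => dotp (T x) xi ^+ 2))//.
- congr EFin; apply: eq_bigr => i _; congr (_ * _).
  under eq_fun do rewrite dotp_Tperp.
  by rewrite cubeE_quadratic_form ?facet_sign_sqr.
- by move=> d' S g mg; apply: measurable_funX; exact: coord_measurable_dotpT.
- by move=> x; exact: sqr_ge0.
- by move=> i; under eq_fun do rewrite dotp_Tperp; exact: bmfun_quadratic_form.
Qed.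

Lemma variance_enorm_sqr_le l :
  (forall b, \sum_a gram a b ^+ 2 <= l * gram b b) ->
  ('V_P[fun w => (enorm (T (X w)) ^+ 2)%R] <= (6 * l * M)%:E)%E.
Proof.
move=> gl; rewrite /variance unlock expectation_enorm_sqr /=.
rewrite (_ : _ * _ = fun w => (dotp (T (X w)) (T (X w)) - M) ^+ 2); last first.
  by apply/funext => w /=; rewrite -enorm_sqr expr2.
rewrite (expectation_facets theta1 UU thetaU XK
  (f := fun x => (dotp (T x) (T x) - M) ^+ 2)).
- rewrite lee_fin.
  apply: le_trans (mixture_variance_le (weight_ge0 theta U) weight_sum1 gl erefl).
  apply: ler_sum => i _; apply: ler_wpM2l; first exact: weight_ge0.
  under eq_fun do rewrite dotp_Tperp_self.
  apply: cubeE_quadratic_form_dev_le; first by rewrite facet_sign_sqr.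
  by move=> a b; rewrite /gram dotpC.
- move=> d' S g mg; apply: measurable_funX; apply: measurable_funB => //.
  exact: coord_measurable_dotpTT.
- by move=> x; exact: sqr_ge0.
- move=> i; under eq_fun do rewrite dotp_Tperp_self.
  by apply: bmfunX; apply: bmfunD; [exact: bmfun_quadratic_form|exact: bmfun_cst].
Qed.

(** The facet means of the form <z_a, xi> <z_b, xi> are at least a third of its
    trace, and after normalisation of xi their average is at most lambda^2. *)
Lemma sum_dotp_sqr_le_lambda xi (r : R) : lambda_sq P (fun w => T (X w)) = r%:E ->
  \sum_a dotp (Tperp a) xi ^+ 2 <= 3 * r * dotp xi xi.
Proof.
move=> lr; have [xi0|xi_neq0] := eqVneq (dotp xi xi) 0.
  rewrite xi0 mulr0 (dotp_eq0 xi0) big1// => a _.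
  by rewrite dotp0r expr0n.
have xi_gt0 : 0 < dotp xi xi by rewrite lt_neqAle eq_sym xi_neq0 dotp_ge0.
pose u := (enorm xi)^-1 *: xi.
have : ((\sum_i p i * facet_mean (fun a b => dotp (Tperp a) u * dotp (Tperp b) u) i)%:E
    <= r%:E)%E.
  rewrite -expectation_dotp_sqr -lr; apply: ereal_sup_ubound.
  by exists u => //; exact: normalize_unit_sphere.
rewrite lee_fin.
set S := \sum_i _ => Sr.
have : (\sum_a dotp (Tperp a) u ^+ 2) / 3 <= S.
  have -> : (\sum_a dotp (Tperp a) u ^+ 2) / 3 =
      \sum_i p i * ((\sum_a dotp (Tperp a) u ^+ 2) / 3).
    by rewrite -mulr_suml weight_sum1 mul1r.
  apply: ler_sum => i _.
  apply: ler_wpM2l; first exact: weight_ge0.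
  rewrite /facet_mean lerDl mulr_ge0// -expr2 sqr_ge0//.
have -> : \sum_a dotp (Tperp a) u ^+ 2 = (\sum_a dotp (Tperp a) xi ^+ 2) / dotp xi xi.
  rewrite mulr_suml; apply: eq_bigr => a _.
  by rewrite dotpZr exprMn exprVn enorm_sqr mulrC.
move=> H; rewrite -ler_pdivrMr//; lra.
Qed.

Lemma variance_conjecture_hyperplane_projection :
  ('V_P[fun w => (enorm (T (X w)) ^+ 2)%R] <=
       18%:E * lambda_sq P (fun w => T (X w)) *
       'E_P[fun w => (enorm (T (X w)) ^+ 2)%R])%E.
Proof.
rewrite expectation_enorm_sqr.
have gram0 b : 0 <= gram b b := dotp_ge0 _.
have ME : M = (\sum_a gram a a) / 3 + 2 / 3 * \sum_i p i * gram i i.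
  rewrite /M (eq_bigr (fun i => (\sum_a gram a a) / 3 * p i + 2 / 3 * (p i * gram i i))).
    by rewrite big_split -!mulr_sumr weight_sum1 mulr1.
  by move=> i _; rewrite /facet_mean; ring.
have tr0 : 0 <= \sum_a gram a a by apply: sumr_ge0.
have g0 : 0 <= \sum_i p i * gram i i.
  by apply: sumr_ge0 => i _; rewrite mulr_ge0// weight_ge0.
(* If M = 0, every Tperp b vanishes and the variance bound holds with l = 0,
   whatever the value of lambda, infinite ones included. *)
have [M0|M_neq0] := eqVneq M 0.
  rewrite M0 mule0; have := @variance_enorm_sqr_le 0; rewrite mulr0 mul0r; apply.
  have : \sum_a gram a a == 0 by apply/eqP; move: M0; rewrite ME; lra.
  rewrite psumr_eq0// => /allP tr_eq0 b.
  have Tb : Tperp b = 0.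
    by apply: dotp_eq0; apply/eqP; exact: tr_eq0 (mem_index_enum b).
  rewrite mul0r big1// => a _.
  by rewrite /gram Tb dotp0r expr0n.
have M_gt0 : 0 < M by rewrite lt_neqAle eq_sym M_neq0 ME; lra.
case lE : (lambda_sq P (fun w => T (X w))) => [r| |].
- rewrite -!EFinM.
  apply: le_trans (variance_enorm_sqr_le (l := 3 * r) _) _.
    by move=> b; exact: (sum_dotp_sqr_le_lambda (Tperp b) lE).
  by rewrite lee_fin; lra.
- by rewrite mulry gtr0_sg// mul1e mulyr gtr0_sg// mul1e leey.
(* The supremum is over a nonempty set: some Tperp b can be normalised. *)
- exfalso.
  have [b b_gt0] : exists b, 0 < gram b b.
    apply: contrapT => H; move/eqP: M_neq0; apply.
    have G0 b : gram b b = 0.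
      by apply/eqP; rewrite eq_le gram0 andbT leNgt; apply/negP => ?; apply: H; exists b.
    rewrite ME !big1 ?mul0r ?mulr0 ?addr0// => i _.
    by rewrite G0 mulr0.
  have := @ereal_sup_ubound R
    [set 'E_P[fun w => (dotp (T (X w)) xi ^+ 2)%R]%E |
      xi in @unit_sphere R k]
    _ (ex_intro2 _ _ _ (normalize_unit_sphere b_gt0) erefl).
  rewrite -/(lambda_sq P _) lE expectation_dotp_sqr.
  by rewrite leeNy_eq.
Qed.
End Final.

Theorem corollary3p3 (R : realType) :
  exists2 C : R, 0 < C &
    forall (n : nat) (theta : 'cV[R]_n) (k : nat)
      (T : {linear 'cV[R]_n -> 'cV[R]_k})
      (d : measure_display) (Omega : measurableType d) (P : probability Omega R)
      (X : {RV P >-> borel_cV R n}),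
    (2 <= n)%N -> unit_sphere theta ->
    uniform_on_perp theta (proj_perp theta @` @cube R n) X ->
    ('V_P[fun w => (enorm (T (X w)) ^+ 2)%R] <=
       C%:E * lambda_sq P (fun w => T (X w)) *
       'E_P[fun w => (enorm (T (X w)) ^+ 2)%R])%E.
Proof.
exists 18 => // n theta k T d Omega P X; case: n theta T X => // m theta T X _.
move=> theta1 [U [[UU thetaU] XK]].
exact: (variance_conjecture_hyperplane_projection _ theta1 UU thetaU XK).
Qed.
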